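(* Consider the system in the real independent variables $(s,t)$ and the six real dependent variables $\vec\kappa=(\kappa_1,\kappa_2)$, $\vec\omega=(\omega_1,\omega_2)$, $\vec\upsilon=(\upsilon_1,\upsilon_2)$: $$\partial_t\kappa_1=\partial_s\omega_1,\quad \partial_t\kappa_2=\partial_s\omega_2,\quad \partial_s\upsilon_1=\omega_2,\quad \partial_s\upsilon_2=-\omega_1,\quad \omega_1\kappa_2-\omega_2\kappa_1=0,\quad \upsilon_1\kappa_2-\upsilon_2\kappa_1=0. \qquad (\ast)$$ For real-analytic functions $A(u)$, $C(u)$ and $F$ of one real variable, consider the expressions $$\begin{pmatrix}\kappa_1\\ \kappa_2\end{pmatrix}=-\frac{A(u)^2C'(u)}{A'(u)s+1}\begin{pmatrix}\cos C(u)\\ \sin C(u)\end{pmatrix},$$ $$\begin{pmatrix}\omega_1\\ \omega_2\end{pmatrix}=\frac{A(u)C'(u)}{F'(A(u)s+u)\,(A'(u)s+1)}\begin{pmatrix}\cos C(u)\\ \sin C(u)\end{pmatrix},$$ $$\begin{pmatrix}\upsilon_1\\ \upsilon_2\end{pmatrix}=\frac{1}{F'(A(u)s+u)}\begin{pmatrix}\cos C(u)\\ \sin C(u)\end{pmatrix},\qquad t=F(A(u)s+u), \qquad (\ast\ast)$$ where $u=u(s,t)$ is a real-analytic function satisfying the last relation, and where $F'(A(u)s+u)\neq 0$ and $A'(u)s+1\neq 0$. Then $(\ast\ast)$ is a solution of $(\ast)$, and it is the general analytic solution of $(\ast)$ in the sense defined in the context.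
   Context: A prime denotes differentiation of a function of one variable with respect to its argument. Only solutions with non-vanishing dependent variables are considered: $\omega_1\omega_2\kappa_1\kappa_2\upsilon_1\upsilon_2\neq 0$. Analytic means real-analytic. Meaning of ''general'': for every point $(s_0,t_0)\in\mathbb{R}^2$ and every analytic solution $(\vec\kappa,\vec\omega,\vec\upsilon)$ of $(\ast)$ defined in a neighbourhood of $(s_0,t_0)$ with $\omega_1\omega_2\kappa_1\kappa_2\upsilon_1\upsilon_2\neq0$ there, the following holds. After translating the independent variables so that $(s_0,t_0)$ becomes the origin (i.e. replacing $(s,t)$ by $(s-s_0,t-t_0)$; the system is translation invariant), there exist real-analytic functions $A,C,F$ of one variable, defined near $u=0$, with $F(0)=0$ and $F'(0)\neq 0$, and a real-analytic function $u(s,t)$ near $(0,0)$ with $u(0,0)=0$ and $t=F(A(u)s+u)$, such that the solution is given by the formulas $(\ast\ast)$ in some neighbourhood of the origin. *)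

(* Defs.v *)
From Stdlib Require Export Reals.
From Coquelicot Require Export Coquelicot.
Open Scope R_scope.

Definition analytic1 (f : R -> R) (x0 : R) : Prop :=
  exists a : nat -> R, locally x0 (fun x => is_pseries a (x - x0) (f x)).

(** The double series is grouped by total degree; the first clause says that
    the family of monomials [a i j * h^i * k^j] is absolutely summable, so
    the value in the second clause is its unordered sum. *)
Definition analytic2 (f : R -> R -> R) (s0 t0 : R) : Prop :=
  exists a : nat -> nat -> R,
    locally ((s0, t0) : R * R) (fun p =>
      let h := fst p - s0 in
      let k := snd p - t0 in
      ex_series (fun n =>
        sum_n (fun i => Rabs (a i (n - i)%nat * h ^ i * k ^ (n - i))) n) /\
      is_series (fun n =>
        sum_n (fun i => a i (n - i)%nat * h ^ i * k ^ (n - i)) n)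
        (f (fst p) (snd p))).

Definition D_s (f : R -> R -> R) (s t : R) : R := Derive (fun x => f x t) s.
Definition D_t (f : R -> R -> R) (s t : R) : R := Derive (fun y => f s y) t.

Record fields : Type := Fields {
  kappa1 : R -> R -> R;
  kappa2 : R -> R -> R;
  omega1 : R -> R -> R;
  omega2 : R -> R -> R;
  upsilon1 : R -> R -> R;
  upsilon2 : R -> R -> R
}.

Definition analytic_at (X : fields) (s t : R) : Prop :=
  analytic2 (kappa1 X) s t /\ analytic2 (kappa2 X) s t /\
  analytic2 (omega1 X) s t /\ analytic2 (omega2 X) s t /\
  analytic2 (upsilon1 X) s t /\ analytic2 (upsilon2 X) s t.

Definition system_at (X : fields) (s t : R) : Prop :=
  D_t (kappa1 X) s t = D_s (omega1 X) s t /\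
  D_t (kappa2 X) s t = D_s (omega2 X) s t /\
  D_s (upsilon1 X) s t = omega2 X s t /\
  D_s (upsilon2 X) s t = - omega1 X s t /\
  omega1 X s t * kappa2 X s t - omega2 X s t * kappa1 X s t = 0 /\
  upsilon1 X s t * kappa2 X s t - upsilon2 X s t * kappa1 X s t = 0.

(** [Derive] is total, with a junk value where the derivative does not exist;
    the analyticity clause guarantees that all the partial derivatives in
    [system_at] are genuine. *)
Definition analytic_solution (U : R * R -> Prop) (X : fields) : Prop :=
  forall s t : R, U (s, t) -> analytic_at X s t /\ system_at X s t.

Definition nonvanishing (U : R * R -> Prop) (X : fields) : Prop :=
  forall s t : R, U (s, t) ->
    omega1 X s t * omega2 X s t * kappa1 X s t * kappa2 X s t *
    upsilon1 X s t * upsilon2 X s t <> 0.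

Definition formula (A C F : R -> R) (u : R -> R -> R) : fields :=
  let k s t := - ((A (u s t)) ^ 2 * Derive C (u s t)
                  / (Derive A (u s t) * s + 1)) in
  let w s t := A (u s t) * Derive C (u s t)
               / (Derive F (A (u s t) * s + u s t)
                  * (Derive A (u s t) * s + 1)) in
  let v s t := 1 / Derive F (A (u s t) * s + u s t) in
  Fields
    (fun s t => k s t * cos (C (u s t))) (fun s t => k s t * sin (C (u s t)))
    (fun s t => w s t * cos (C (u s t))) (fun s t => w s t * sin (C (u s t)))
    (fun s t => v s t * cos (C (u s t))) (fun s t => v s t * sin (C (u s t))).

(** [A], [C], [F] need only be analytic at the points where [formula]
    evaluates them, so that they may be defined on open subsets of [R] only. *)
Definition admissible (U : R * R -> Prop) (A C F : R -> R) (u : R -> R -> R)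
  : Prop :=
  forall s t : R, U (s, t) ->
    analytic2 u s t /\
    analytic1 A (u s t) /\ analytic1 C (u s t) /\
    analytic1 F (A (u s t) * s + u s t) /\
    t = F (A (u s t) * s + u s t) /\
    Derive F (A (u s t) * s + u s t) <> 0 /\
    Derive A (u s t) * s + 1 <> 0.

Definition translate (s0 t0 : R) (X : fields) : fields :=
  Fields
    (fun s t => kappa1 X (s + s0) (t + t0))
    (fun s t => kappa2 X (s + s0) (t + t0))
    (fun s t => omega1 X (s + s0) (t + t0))
    (fun s t => omega2 X (s + s0) (t + t0))
    (fun s t => upsilon1 X (s + s0) (t + t0))
    (fun s t => upsilon2 X (s + s0) (t + t0)).

Definition agree_on (U : R * R -> Prop) (X Y : fields) : Prop :=
  forall s t : R, U (s, t) ->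
    kappa1 X s t = kappa1 Y s t /\ kappa2 X s t = kappa2 Y s t /\
    omega1 X s t = omega1 Y s t /\ omega2 X s t = omega2 Y s t /\
    upsilon1 X s t = upsilon1 Y s t /\ upsilon2 X s t = upsilon2 Y s t.

(* Main.v *)
Require Import Defs.
From Stdlib Require Import Reals Lra Lia IndefiniteDescription Classical.
From Coquelicot Require Import Coquelicot.
Open Scope R_scope.

(** That the formula solves the system is a computation. Put
    [w = A(u) s + u]. Differentiating [t = F(w)] gives [w_s = 0], hence
    [u_s = - A / (A' s + 1)] and [u_t = 1 / (F'(w) (A' s + 1))]
    ([phase_partials]); each equation of the system then becomes a field
    identity ([formula_system]). The fields are analytic because analytic
    functions are closed under products, quotients, differentiation and
    composition ([formula_analytic]).

    Conversely, the two algebraic equations say that the plane vectors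
    [kappa], [omega], [upsilon] are parallel, so that a nonvanishing solution
    has the form [kappa = k e], [omega = w e], [upsilon = rho e] with
    [e = (cos theta, sin theta)] ([polar_form]). In these variables the
    system reads [rho_s = 0], [rho theta_s = - w], [k_t = w_s],
    [k theta_t = w theta_s] ([polar_system]). With [a = - rho k / w], the
    last equations and [theta_st = theta_ts] give the transport equations
    [rho theta_s + a theta_t = 0] and [rho a_s + a a_t = 0]
    ([angle_transport], [speed_transport]). Since [rho] depends on [t] only,
    one may use a primitive [G] of [rho] as a new time; the second equation
    then becomes Burgers' equation, whose characteristics are the straight
    lines of slope [a]. So [a] and [theta] are constant along the line
    through [(s, t)], which meets [s = 0] at the new time
    [u = G(t) - a(s,t) s] ([constant_along_characteristic]). Reading off the
    values on [s = 0] produces [F = G^-1], [A = a(0, F)], [C = theta(0, F)],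
    and [u] is analytic because [G] and [a] are.
    Differentiating [a = A(u)] and [theta = C(u)] in [t] gives
    [u_t (A' s + 1) = rho], and with it the formula
    ([polar_general_solution]).

    The analytic input is a small theory of real power series. A function
    of two variables is expanded by total degree into homogeneous polynomials
    whose coefficients have summable absolute values
    ([analytic2_expansion]). The two results of substance are composition
    ([analytic2_comp]), which rests on an exchange of summations
    ([comp_coef_series]), and the analytic local inverse
    ([analytic1_local_inverse]), whose coefficients are the fixed point of a
    contraction on formal series. The differential calculus uses only that an
    analytic function is differentiable at the centre of its expansion and
    locally Lipschitz: the first gives the symmetry of the mixed derivatives
    of [theta] ([mixed_partials_eq]), the second the uniqueness along
    characteristics ([gronwall_zero]). *)

(** * Homogeneous polynomials and expansions by degree *)

Lemma pos_series_bounded (a : nat -> R) (M : R) :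
  (forall n, 0 <= a n) -> (forall n, sum_f_R0 a n <= M) ->
  ex_series a /\ Series a <= M.
Proof.
  intros Ha HM.
  destruct (ex_finite_lim_seq_incr (sum_n a) M) as [l Hl].
  - intros n. rewrite sum_Sn. unfold plus; simpl. specialize (Ha (S n)). lra.
  - intros n. rewrite sum_n_Reals. apply HM.
  - split; [exists l; exact Hl|].
    rewrite (is_series_unique _ _ Hl).
    apply (is_lim_seq_le (sum_n a) (fun _ => M) l M);
      [|exact Hl|apply is_lim_seq_const].
    intros n. rewrite sum_n_Reals. apply HM.
Qed.

Lemma sum_le_series (a : nat -> R) (l : R) (n : nat) :
  (forall n, 0 <= a n) -> is_series a l -> sum_f_R0 a n <= l.
Proof.
  intros Ha Hl. rewrite <- sum_n_Reals.
  apply (is_lim_seq_incr_compare (sum_n a) l); [exact Hl|].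
  intros m. rewrite sum_Sn. unfold plus; simpl. specialize (Ha (S m)). lra.
Qed.

Lemma ex_series_le_R (a b : nat -> R) :
  (forall n, Rabs (a n) <= b n) -> ex_series b -> ex_series a.
Proof. exact (@ex_series_le R_AbsRing R_CompleteNormedModule a b). Qed.

Lemma ex_series_ext_R (a b : nat -> R) :
  (forall n, a n = b n) -> ex_series a -> ex_series b.
Proof. exact (@ex_series_ext R_AbsRing R_NormedModule a b). Qed.

Lemma is_series_ext_R (a b : nat -> R) (l : R) :
  (forall n, a n = b n) -> is_series a l -> is_series b l.
Proof. exact (@is_series_ext R_AbsRing R_NormedModule a b l). Qed.

Lemma sum_shift_zero (c : nat -> R) (n : nat) :
  c 0%nat = 0 -> sum_f_R0 c (S n) = sum_f_R0 (fun i => c (S i)) n.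
Proof.
  intros H. rewrite (decomp_sum c (S n)) by lia. simpl. rewrite H. ring.
Qed.

(** [homogeneous n B p]: the function [p] is a homogeneous polynomial of
    degree [n] whose coefficients have absolute sum at most [B]. Generating
    these functions inductively, instead of carrying coefficient arrays,
    reduces the rule for products to an induction on one factor;
    [homogeneous_coef] and [homogeneous_monomials] recover the coefficients. *)
Inductive homogeneous : nat -> R -> (R -> R -> R) -> Prop :=
| homogeneous_const c : homogeneous 0 (Rabs c) (fun _ _ => c)
| homogeneous_fst n B p : homogeneous n B p -> homogeneous (S n) B (fun h k => h * p h k)
| homogeneous_snd n B p : homogeneous n B p -> homogeneous (S n) B (fun h k => k * p h k)
| homogeneous_zero n : homogeneous n 0 (fun _ _ => 0)
| homogeneous_add n B C p q :
    homogeneous n B p -> homogeneous n C q -> homogeneous n (B + C) (fun h k => p h k + q h k)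
| homogeneous_weaken n B C p q :
    homogeneous n B p -> B <= C -> (forall h k, p h k = q h k) -> homogeneous n C q.

Lemma homogeneous_nonneg n B p : homogeneous n B p -> 0 <= B.
Proof.
  induction 1; try lra. apply Rabs_pos.
Qed.

Lemma homogeneous_scal n B p c : homogeneous n B p -> homogeneous n (Rabs c * B) (fun h k => c * p h k).
Proof.
  induction 1 as [d|n B p _ IH|n B p _ IH|n|n B C p q _ IHp _ IHq|n B C p q _ IH HB Heq].
  - rewrite <- Rabs_mult. apply homogeneous_const.
  - apply (homogeneous_weaken _ _ _ _ _ (homogeneous_fst _ _ _ IH)); intros; try ring; lra.
  - apply (homogeneous_weaken _ _ _ _ _ (homogeneous_snd _ _ _ IH)); intros; try ring; lra.
  - apply (homogeneous_weaken _ _ _ _ _ (homogeneous_zero n)); intros; try ring; lra.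
  - apply (homogeneous_weaken _ _ _ _ _ (homogeneous_add _ _ _ _ _ IHp IHq)); intros; try ring; lra.
  - apply (homogeneous_weaken _ _ _ _ _ IH).
    + apply Rmult_le_compat_l; [apply Rabs_pos|exact HB].
    + intros h k; rewrite Heq; ring.
Qed.

Lemma homogeneous_mult m n B C p q :
  homogeneous m B p -> homogeneous n C q -> homogeneous (m + n) (B * C) (fun h k => p h k * q h k).
Proof.
  intros Hp Hq. pose proof (homogeneous_nonneg _ _ _ Hq) as HC.
  induction Hp as [d|m B p _ IH|m B p _ IH|m|m B D p p' _ IHp _ IHq|m B D p p' _ IH HB Heq]; simpl.
  - apply homogeneous_scal, Hq.
  - apply (homogeneous_weaken _ _ _ _ _ (homogeneous_fst _ _ _ IH)); intros; try ring; lra.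
  - apply (homogeneous_weaken _ _ _ _ _ (homogeneous_snd _ _ _ IH)); intros; try ring; lra.
  - apply (homogeneous_weaken _ _ _ _ _ (homogeneous_zero (m + n))); intros; try ring; lra.
  - apply (homogeneous_weaken _ _ _ _ _ (homogeneous_add _ _ _ _ _ IHp IHq)); intros; try ring; lra.
  - apply (homogeneous_weaken _ _ _ _ _ IH).
    + apply Rmult_le_compat_r; assumption.
    + intros h k; rewrite Heq; ring.
Qed.

Lemma homogeneous_sum m n (B : nat -> R) (p : nat -> R -> R -> R) :
  (forall i, (i <= n)%nat -> homogeneous m (B i) (p i)) ->
  homogeneous m (sum_f_R0 B n) (fun h k => sum_f_R0 (fun i => p i h k) n).
Proof.
  induction n as [|n IH]; intros H; simpl.
  - apply H; lia.
  - apply (homogeneous_add _ _ _ (fun h k => sum_f_R0 (fun i => p i h k) n) (p (S n)));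
      [apply IH; intros; apply H|apply H]; lia.
Qed.

Lemma homogeneous_bound n B p d h k :
  homogeneous n B p -> Rabs h <= d -> Rabs k <= d -> Rabs (p h k) <= B * d ^ n.
Proof.
  intros Hp Hh Hk. assert (Hd : 0 <= d) by (pose proof (Rabs_pos h); lra).
  induction Hp as [c|n B p _ IH|n B p _ IH|n|n B C p q _ IHp _ IHq|n B C p q _ IH HB Heq]; simpl.
  - lra.
  - rewrite Rabs_mult. replace (B * (d * d ^ n)) with (d * (B * d ^ n)) by ring.
    apply Rmult_le_compat; auto using Rabs_pos.
  - rewrite Rabs_mult. replace (B * (d * d ^ n)) with (d * (B * d ^ n)) by ring.
    apply Rmult_le_compat; auto using Rabs_pos.
  - rewrite Rabs_R0. lra.
  - eapply Rle_trans; [apply Rabs_triang|]. lra.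
  - rewrite <- Heq. eapply Rle_trans; [exact IH|].
    apply Rmult_le_compat_r; [apply pow_le, Hd|exact HB].
Qed.

Lemma homogeneous_lipschitz n B p d h k k' :
  homogeneous n B p -> Rabs h <= d -> Rabs k <= d -> Rabs k' <= d ->
  Rabs (p h k - p h k') <= INR n * B * d ^ (n - 1) * Rabs (k - k').
Proof.
  intros Hp Hh Hk Hk'. assert (Hd : 0 <= d) by (pose proof (Rabs_pos h); lra).
  assert (Hdeg : forall n, INR n * d ^ (n - 1) * d = INR n * d ^ n).
  { intros [|m]; simpl; [ring|]. rewrite Nat.sub_0_r. ring. }
  induction Hp as [c|n B p Hp IH|n B p Hp IH|n|n B C p q _ IHp _ IHq|n B C p q _ IH HB Heq].
  - replace (c - c) with 0 by ring. rewrite Rabs_R0. simpl. lra.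
  - rewrite S_INR. simpl. rewrite Nat.sub_0_r.
    replace (h * p h k - h * p h k') with (h * (p h k - p h k')) by ring.
    rewrite Rabs_mult.
    apply Rle_trans with (d * (INR n * B * d ^ (n - 1) * Rabs (k - k'))).
    + apply Rmult_le_compat; auto using Rabs_pos.
    + replace (d * (INR n * B * d ^ (n - 1) * Rabs (k - k')))
        with (B * Rabs (k - k') * (INR n * d ^ (n - 1) * d)) by ring.
      rewrite Hdeg.
      assert (0 <= B * Rabs (k - k') * d ^ n).
      { repeat apply Rmult_le_pos; auto using Rabs_pos, pow_le.
        eapply homogeneous_nonneg, Hp. }
      lra.
  - rewrite S_INR. simpl. rewrite Nat.sub_0_r.
    replace (k * p h k - k' * p h k') with (k * (p h k - p h k') + (k - k') * p h k')
      by ring.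
    eapply Rle_trans; [apply Rabs_triang|]. rewrite !Rabs_mult.
    apply Rle_trans with (d * (INR n * B * d ^ (n - 1) * Rabs (k - k'))
      + Rabs (k - k') * (B * d ^ n)).
    + apply Rplus_le_compat.
      * apply Rmult_le_compat; auto using Rabs_pos.
      * apply Rmult_le_compat_l; auto using Rabs_pos.
        apply (homogeneous_bound n B p d h k' Hp); assumption.
    + replace (d * (INR n * B * d ^ (n - 1) * Rabs (k - k')))
        with (B * Rabs (k - k') * (INR n * d ^ (n - 1) * d)) by ring.
      rewrite Hdeg. lra.
  - rewrite Rminus_diag, Rabs_R0. lra.
  - replace (p h k + q h k - (p h k' + q h k'))
      with ((p h k - p h k') + (q h k - q h k')) by ring.
    eapply Rle_trans; [apply Rabs_triang|]. lra.
  - rewrite <- !Heq. eapply Rle_trans; [exact IH|].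
    apply Rmult_le_compat_r; [apply Rabs_pos|].
    apply Rmult_le_compat_r; [apply pow_le, Hd|].
    apply Rmult_le_compat_l; [apply pos_INR|exact HB].
Qed.

Lemma homogeneous_monomials n (c : nat -> R) :
  homogeneous n (sum_f_R0 (fun i => Rabs (c i)) n)
    (fun h k => sum_f_R0 (fun i => c i * h ^ i * k ^ (n - i)) n).
Proof.
  apply (homogeneous_sum n n (fun i => Rabs (c i)) (fun i h k => c i * h ^ i * k ^ (n - i))).
  intros i Hi.
  assert (Hk : forall j, homogeneous j (Rabs (c i)) (fun _ k => c i * k ^ j)).
  { induction j as [|j IH].
    - apply (homogeneous_weaken _ _ _ _ _ (homogeneous_const (c i))); intros; simpl; lra.
    - apply (homogeneous_weaken _ _ _ _ _ (homogeneous_snd _ _ _ IH)); intros; simpl; lra. }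
  assert (H : forall j m, homogeneous (j + m) (Rabs (c i)) (fun h k => c i * h ^ j * k ^ m)).
  { induction j as [|j IH]; intros m.
    - apply (homogeneous_weaken _ _ _ _ _ (Hk m)); intros; simpl; lra.
    - apply (homogeneous_weaken _ _ _ _ _ (homogeneous_fst _ _ _ (IH m))); intros; simpl; lra. }
  specialize (H i (n - i)%nat). replace (i + (n - i))%nat with n in H by lia. exact H.
Qed.

(** Multiplication by the first variable shifts the coefficients; by the
    second it appends a zero coefficient. *)
Lemma homogeneous_coef n B p : homogeneous n B p -> exists c : nat -> R,
  (forall h k, p h k = sum_f_R0 (fun i => c i * h ^ i * k ^ (n - i)) n) /\
  sum_f_R0 (fun i => Rabs (c i)) n <= B.
Proof.
  induction 1 as [c|n B p _ [c [Hc HB]]|n B p _ [c [Hc HB]]|n|n B C p q _ [c [Hc HB]] _ [d [Hd HC]]|n B C p q _ [c [Hc HB]] HBC Heq].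
  - exists (fun _ => c). split; intros; simpl; lra.
  - exists (fun i => match i with O => 0 | S j => c j end). split.
    + intros h k. rewrite sum_shift_zero by ring. rewrite Hc, scal_sum.
      apply sum_eq; intros i Hi. simpl. ring.
    + rewrite sum_shift_zero by apply Rabs_R0. exact HB.
  - exists (fun i => if Nat.leb i n then c i else 0). split.
    + intros h k. rewrite tech5, Hc, scal_sum.
      replace (Nat.leb (S n) n) with false by (symmetry; apply Nat.leb_gt; lia).
      rewrite !Rmult_0_l, Rplus_0_r. apply sum_eq; intros i Hi.
      replace (Nat.leb i n) with true by (symmetry; apply Nat.leb_le; lia).
      replace (S n - i)%nat with (S (n - i)) by lia. simpl. ring.
    + rewrite tech5.
      replace (Nat.leb (S n) n) with false by (symmetry; apply Nat.leb_gt; lia).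
      rewrite Rabs_R0, Rplus_0_r. eapply Rle_trans; [|exact HB].
      apply Req_le, sum_eq; intros i Hi.
      replace (Nat.leb i n) with true by (symmetry; apply Nat.leb_le; lia). reflexivity.
  - exists (fun _ => 0). split.
    + intros h k. symmetry. apply sum_eq_R0. intros; ring.
    + apply Req_le, sum_eq_R0. intros; apply Rabs_R0.
  - exists (fun i => c i + d i). split.
    + intros h k. rewrite Hc, Hd, <- sum_plus. apply sum_eq; intros; ring.
    + apply Rle_trans with (sum_f_R0 (fun i => Rabs (c i) + Rabs (d i)) n).
      * apply sum_Rle; intros; apply Rabs_triang.
      * rewrite sum_plus. lra.
  - exists c. split; [intros; rewrite <- Heq; apply Hc|lra].
Qed.

Lemma locally_prod (P : R * R -> Prop) (s t : R) :
  locally (s, t) P <->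
  exists r, 0 < r /\ forall x y, Rabs (x - s) < r -> Rabs (y - t) < r -> P (x, y).
Proof.
  split.
  - intros [e He]. exists e. split; [apply cond_pos|].
    intros x y Hx Hy. apply He. split; assumption.
  - intros [r [Hr H]]. exists (mkposreal r Hr). intros [x y] [Hx Hy].
    apply H; assumption.
Qed.

Lemma locally_R (P : R -> Prop) (t : R) :
  locally t P <-> exists r, 0 < r /\ forall y, Rabs (y - t) < r -> P y.
Proof.
  split.
  - intros [e He]. exists e. split; [apply cond_pos|]. intros y Hy. apply He, Hy.
  - intros [r [Hr H]]. exists (mkposreal r Hr). intros y Hy. apply H, Hy.
Qed.

(** An expansion converging up to the closed square of half-side [r]; the
    numbers [N n * r ^ n] dominate the homogeneous parts on that square. *)
Definition expansion2 (f : R -> R -> R) (s t : R)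
  (N : nat -> R) (p : nat -> R -> R -> R) (r : R) : Prop :=
  0 < r /\ (forall n, homogeneous n (N n) (p n)) /\ ex_series (fun n => N n * r ^ n) /\
  (forall h k, Rabs h <= r -> Rabs k <= r ->
     is_series (fun n => p n h k) (f (s + h) (t + k))).

(** Absolute convergence at one point of the diagonal dominates the family
    on a whole square, which yields the bounds [N]; in the other direction a
    choice of coefficients in each degree gives the array. *)
Lemma analytic2_expansion f s t :
  analytic2 f s t <-> exists N p r, expansion2 f s t N p r.
Proof.
  split.
  - intros [a H]. apply locally_prod in H. destruct H as [e [He H]].
    exists (fun n => sum_f_R0 (fun i => Rabs (a i (n - i)%nat)) n),
      (fun n h k => sum_f_R0 (fun i => a i (n - i)%nat * h ^ i * k ^ (n - i)) n), (e / 2).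
    repeat split.
    + lra.
    + intros n. apply homogeneous_monomials.
    + destruct (H (s + e / 2) (t + e / 2)) as [Hs _].
      { ring_simplify (s + e / 2 - s). rewrite Rabs_pos_eq; lra. }
      { ring_simplify (t + e / 2 - t). rewrite Rabs_pos_eq; lra. }
      cbn [fst snd] in Hs. revert Hs. apply ex_series_ext. intros n.
      rewrite sum_n_Reals, Rmult_comm, scal_sum. apply sum_eq. intros i Hi.
      replace (s + e / 2 - s) with (e / 2) by ring.
      replace (t + e / 2 - t) with (e / 2) by ring.
      rewrite Rmult_assoc, <- pow_add, Rabs_mult.
      replace (i + (n - i))%nat with n by lia.
      rewrite (Rabs_pos_eq ((e / 2) ^ n)) by (apply pow_le; lra). reflexivity.
    + intros h k Hh Hk. destruct (H (s + h) (t + k)) as [_ Hv].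
      { replace (s + h - s) with h by ring. lra. }
      { replace (t + k - t) with k by ring. lra. }
      cbn [fst snd] in Hv. revert Hv. apply is_series_ext. intros n.
      rewrite sum_n_Reals. replace (s + h - s) with h by ring.
      replace (t + k - t) with k by ring. reflexivity.
  - intros [N [p [r [Hr [Hp [HN Hs]]]]]].
    destruct (functional_choice
      (fun n c => (forall h k, p n h k = sum_f_R0 (fun i => c i * h ^ i * k ^ (n - i)) n) /\
         sum_f_R0 (fun i => Rabs (c i)) n <= N n)
      (fun n => homogeneous_coef n _ _ (Hp n))) as [c Hc].
    exists (fun i j => c (i + j)%nat i). apply locally_prod. exists r. split; [exact Hr|].
    intros x y Hx Hy. cbn [fst snd]. split.
    + apply ex_series_le_R with (fun n => N n * r ^ n); [|exact HN].
      intros n. rewrite sum_n_Reals, Rabs_pos_eq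
        by (apply cond_pos_sum; intros; apply Rabs_pos).
      apply Rle_trans with (sum_f_R0 (fun i => Rabs (c n i)) n * r ^ n).
      * rewrite (Rmult_comm _ (r ^ n)), scal_sum. apply sum_Rle. intros i Hi.
        replace (i + (n - i))%nat with n by lia.
        rewrite !Rabs_mult, Rmult_assoc.
        apply Rmult_le_compat_l; [apply Rabs_pos|].
        replace n with (i + (n - i))%nat at 2 by lia. rewrite pow_add.
        apply Rmult_le_compat; try apply Rabs_pos; rewrite <- RPow_abs;
          apply pow_incr; split; try apply Rabs_pos; lra.
      * apply Rmult_le_compat_r; [apply pow_le; lra|apply Hc].
    + replace (f x y) with (f (s + (x - s)) (t + (y - t))) by (f_equal; ring).
      generalize (Hs (x - s) (y - t) ltac:(lra) ltac:(lra)). apply is_series_ext. intros n.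
      rewrite (proj1 (Hc n)), sum_n_Reals. apply sum_eq. intros i Hi.
      replace (i + (n - i))%nat with n by lia. reflexivity.
Qed.

(** * Composition of power series *)

(** The coefficients of the [m]-th power of the power series with
    coefficients [x]. *)
Fixpoint conv_pow (x : nat -> R) (m : nat) : nat -> R :=
  match m with
  | O => fun n => match n with O => 1 | S _ => 0 end
  | S m => PS_mult x (conv_pow x m)
  end.

(** The coefficients of the composition of the power series of [c] with that
    of [x], when [x 0 = 0]: by [conv_pow_low] only the powers [m <= n] reach
    the degree [n]. *)
Definition comp_coef (c x : nat -> R) (n : nat) : R :=
  sum_f_R0 (fun m => c m * conv_pow x m n) n.

Lemma conv_pow_abs x X m n :
  (forall n, Rabs (x n) <= X n) -> Rabs (conv_pow x m n) <= conv_pow X m n.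
Proof.
  intros H. revert n. induction m as [|m IH]; intros n; simpl.
  - destruct n; [rewrite Rabs_R1|rewrite Rabs_R0]; lra.
  - unfold PS_mult. eapply Rle_trans; [apply Rsum_abs|]. apply sum_Rle. intros k _.
    rewrite Rabs_mult. apply Rmult_le_compat; auto using Rabs_pos.
Qed.

Lemma conv_pow_scale x r m n : conv_pow (fun n => x n * r ^ n) m n = conv_pow x m n * r ^ n.
Proof.
  revert n. induction m as [|m IH]; intros n; simpl.
  - destruct n; simpl; ring.
  - unfold PS_mult. rewrite (Rmult_comm _ (r ^ n)), scal_sum. apply sum_eq. intros k Hk.
    replace (r ^ n) with (r ^ k * r ^ (n - k)) by (rewrite <- pow_add; f_equal; lia).
    rewrite IH. ring.
Qed.

Lemma comp_coef_scale c x r n : comp_coef c (fun n => x n * r ^ n) n = comp_coef c x n * r ^ n.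
Proof.
  unfold comp_coef. rewrite (Rmult_comm _ (r ^ n)), scal_sum. apply sum_eq. intros m _.
  rewrite conv_pow_scale. ring.
Qed.

Lemma conv_pow_low x m n : x 0%nat = 0 -> (n < m)%nat -> conv_pow x m n = 0.
Proof.
  intros H0. revert n. induction m as [|m IH]; intros n Hn; [lia|].
  simpl. unfold PS_mult. apply sum_eq_R0. intros [|k] Hk.
  - rewrite H0. ring.
  - rewrite IH by lia. ring.
Qed.

Lemma conv_pow_ext x y m n :
  (forall k, (k <= n)%nat -> x k = y k) -> conv_pow x m n = conv_pow y m n.
Proof.
  revert n. induction m as [|m IH]; intros n H; simpl; [reflexivity|].
  apply sum_eq. intros k Hk. rewrite H by lia. f_equal. apply IH.
  intros; apply H; lia.
Qed.

(** When the constant terms vanish, the coefficient of degree [n] of a power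
    of exponent at least 2 involves coefficients of degree less than [n]
    only. This makes the recursion for the inverse series well founded. *)
Lemma conv_pow_ext_lt x y m n :
  x 0%nat = 0 -> y 0%nat = 0 ->
  (forall k, (k < n)%nat -> x k = y k) -> conv_pow x (S (S m)) n = conv_pow y (S (S m)) n.
Proof.
  intros Hx Hy H. change (PS_mult x (conv_pow x (S m)) n = PS_mult y (conv_pow y (S m)) n).
  apply sum_eq. intros k Hk.
  destruct (Nat.eq_dec k 0) as [->|Hk0]; [rewrite Hx, Hy; ring|].
  destruct (Nat.eq_dec k n) as [->|Hkn].
  - rewrite !Nat.sub_diag, !conv_pow_low by (assumption || lia). ring.
  - rewrite H by lia. f_equal. apply conv_pow_ext. intros; apply H; lia.
Qed.

Lemma sum_zero_tail (a : nat -> R) n j :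
  (forall m, (n < m)%nat -> a m = 0) -> sum_f_R0 a (n + j) = sum_f_R0 a n.
Proof.
  intros H. induction j as [|j IH]; [f_equal; lia|].
  rewrite Nat.add_succ_r. simpl. rewrite IH, H by lia. ring.
Qed.

Lemma is_series_finite (u : nat -> R) (K : nat) :
  (forall n, (K < n)%nat -> u n = 0) -> is_series u (sum_f_R0 u K).
Proof.
  intros Hu. apply is_series_Reals. intros eps He. exists K. intros n Hn.
  replace n with (K + (n - K))%nat by lia. rewrite sum_zero_tail by exact Hu.
  unfold Rdist. rewrite Rminus_diag, Rabs_R0. exact He.
Qed.

Lemma is_series_constant_term (u : nat -> R) :
  (forall n, u (S n) = 0) -> is_series u (u 0%nat).
Proof.
  intros Hu. apply (is_series_finite u 0). intros [|n] Hn; [lia|apply Hu].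
Qed.

(** Mertens' theorem on Cauchy products, iterated. *)
Lemma is_series_conv_pow (x : nat -> R) (l : R) m :
  is_series x l -> ex_series (fun n => Rabs (x n)) ->
  is_series (conv_pow x m) (l ^ m) /\ ex_series (fun n => Rabs (conv_pow x m n)).
Proof.
  intros Hl Ha.
  induction m as [|m [IH IHa]]; simpl; split.
  - apply (is_series_constant_term (fun n => match n with O => 1 | S _ => 0 end)). reflexivity.
  - eexists. apply is_series_constant_term. intros; apply Rabs_R0.
  - apply is_series_mult; assumption.
  - apply ex_series_le_R with (PS_mult (fun n => Rabs (x n)) (fun n => Rabs (conv_pow x m n))).
    + intros n. rewrite Rabs_Rabsolu. unfold PS_mult.
      eapply Rle_trans; [apply Rsum_abs|]. apply Req_le, sum_eq.
      intros; apply Rabs_mult.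
    + assert (Habs : forall u : nat -> R, ex_series (fun n => Rabs (u n)) ->
        ex_series (fun n => Rabs (Rabs (u n)))).
      { intros u. apply ex_series_ext_R. intros; symmetry; apply Rabs_Rabsolu. }
      eexists. apply is_series_mult; auto using Series_correct.
Qed.

Lemma sum_diff_bound (a b : nat -> R) K j :
  (forall m, Rabs (a m) <= b m) ->
  Rabs (sum_f_R0 a (K + j) - sum_f_R0 a K) <= sum_f_R0 b (K + j) - sum_f_R0 b K.
Proof.
  intros H. induction j as [|j IH].
  - rewrite Nat.add_0_r, !Rminus_diag, Rabs_R0. lra.
  - rewrite Nat.add_succ_r. simpl.
    replace (sum_f_R0 a (K + j) + a (S (K + j)) - sum_f_R0 a K)
      with ((sum_f_R0 a (K + j) - sum_f_R0 a K) + a (S (K + j))) by ring.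
    eapply Rle_trans; [apply Rabs_triang|]. specialize (H (S (K + j))). lra.
Qed.

Lemma is_series_sum (u : nat -> nat -> R) (l : nat -> R) K :
  (forall m, is_series (u m) (l m)) ->
  is_series (fun n => sum_f_R0 (fun m => u m n) K) (sum_f_R0 l K).
Proof.
  intros H. induction K as [|K IH]; simpl; [apply H|].
  apply (is_series_plus (fun n => sum_f_R0 (fun m => u m n) K) (u (S K))); auto.
Qed.

Lemma is_series_scal_R (c : R) (u : nat -> R) (l : R) :
  is_series u l -> is_series (fun n => c * u n) (c * l).
Proof. exact (is_series_scal c u l). Qed.

(** Exchange of the two summations over powers and degrees. All terms are
    dominated by [Rabs (c m) * conv_pow X m n], whose sum over [n] is
    [Rabs (c m) * Series X ^ m]. Hence the double sum of the dominating terms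
    is at most the sum over [m] of these values, and the error of stopping
    at the power [K] is at most the tail of that series. The terms are plain
    numbers, so the lemma serves both for homogeneous parts in two
    variables and for the formal inverse in one. *)
Lemma comp_coef_series (c x X : nat -> R) (delta : R) :
  X 0%nat = 0 -> (forall n, Rabs (x n) <= X n) ->
  ex_series X -> Series X <= delta ->
  ex_series (fun m => Rabs (c m) * delta ^ m) ->
  ex_series (comp_coef (fun m => Rabs (c m)) X) /\
  Series (comp_coef (fun m => Rabs (c m)) X) <= Series (fun m => Rabs (c m) * delta ^ m) /\
  is_series (comp_coef c x) (Series (fun m => c m * Series x ^ m)).
Proof.
  intros HX0 HxX HX Hdelta Hc.
  assert (HXpos : forall n, 0 <= X n).
  { intros n. eapply Rle_trans; [apply Rabs_pos|apply HxX]. }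
  assert (Hx0 : x 0%nat = 0).
  { specialize (HxX 0%nat). rewrite HX0 in HxX.
    apply Rabs_eq_0, Rle_antisym; [exact HxX|apply Rabs_pos]. }
  assert (HXX : forall n, Rabs (X n) = X n) by (intros; apply Rabs_pos_eq, HXpos).
  assert (Hax : ex_series (fun n => Rabs (x n))).
  { apply ex_series_le_R with X; [|exact HX]. intros; rewrite Rabs_Rabsolu; apply HxX. }
  assert (HaX : ex_series (fun n => Rabs (X n))).
  { apply ex_series_ext_R with X; [|exact HX]. intros; symmetry; apply HXX. }
  set (L := Series X). set (l := Series x).
  set (y := fun m n => Rabs (c m) * conv_pow X m n).
  assert (HL0 : 0 <= L).
  { apply Rle_trans with (sum_f_R0 X 0); [apply HXpos|].
    apply sum_le_series; [exact HXpos|apply Series_correct, HX]. }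
  assert (Hy0 : forall m n, 0 <= y m n).
  { intros m n. apply Rmult_le_pos; [apply Rabs_pos|].
    eapply Rle_trans; [apply Rabs_pos|apply (conv_pow_abs X X)]. intros; rewrite HXX; lra. }
  assert (HyS : forall m, is_series (y m) (Rabs (c m) * L ^ m)).
  { intros m. apply is_series_scal_R. apply is_series_conv_pow; [|exact HaX].
    apply Series_correct, HX. }
  assert (HxS : forall m, is_series (fun n => c m * conv_pow x m n) (c m * l ^ m)).
  { intros m. apply is_series_scal_R. apply is_series_conv_pow; [|exact Hax].
    apply Series_correct, ex_series_Rabs, Hax. }
  assert (Hxy : forall m n, Rabs (c m * conv_pow x m n) <= y m n).
  { intros m n. rewrite Rabs_mult. apply Rmult_le_compat_l; [apply Rabs_pos|].
    apply conv_pow_abs, HxX. }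
  set (Q := comp_coef (fun m => Rabs (c m)) X).
  (* the inner sums may be extended freely, since [conv_pow X m n = 0] for [n < m] *)
  assert (HQ : forall n K, (n <= K)%nat -> Q n = sum_f_R0 (fun m => y m n) K).
  { intros n K HnK. replace K with (n + (K - n))%nat by lia. symmetry.
    apply (sum_zero_tail (fun m => y m n)). intros m Hm. unfold y.
    rewrite conv_pow_low by (assumption || lia). ring. }
  assert (HQ0 : forall n, 0 <= Q n) by (intros; apply cond_pos_sum; intros; apply Hy0).
  assert (HQK : forall n K, sum_f_R0 (fun m => y m n) K <= Q n).
  { intros n K. destruct (Nat.le_gt_cases n K) as [H|H].
    - rewrite (HQ n K H). lra.
    - change (Q n) with (sum_f_R0 (fun m => y m n) n).
      pose proof (sum_diff_bound (fun m => y m n) (fun m => y m n) K (n - K)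
        (fun m => Req_le _ _ (Rabs_pos_eq _ (Hy0 m n)))) as Hd.
      replace (K + (n - K))%nat with n in Hd by lia.
      pose proof (Rabs_pos (sum_f_R0 (fun m => y m n) n - sum_f_R0 (fun m => y m n) K)).
      lra. }
  set (Z := Series (fun m => Rabs (c m) * L ^ m)).
  assert (HcL : forall m, 0 <= Rabs (c m) * L ^ m <= Rabs (c m) * delta ^ m).
  { intros m. split; [apply Rmult_le_pos; auto using Rabs_pos, pow_le|].
    apply Rmult_le_compat_l; [apply Rabs_pos|]. apply pow_incr. auto. }
  assert (HZex : ex_series (fun m => Rabs (c m) * L ^ m)).
  { apply ex_series_le_R with (fun m => Rabs (c m) * delta ^ m); [|exact Hc].
    intros m. rewrite Rabs_pos_eq; apply HcL. }
  assert (HQsum : forall K, sum_f_R0 Q K <= Z).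
  { intros K. apply Rle_trans with (sum_f_R0 (fun m => Rabs (c m) * L ^ m) K).
    - apply Rle_trans with (sum_f_R0 (fun n => sum_f_R0 (fun m => y m n) K) K).
      + apply Req_le, sum_eq. intros n Hn. apply HQ, Hn.
      + apply (sum_le_series (fun n => sum_f_R0 (fun m => y m n) K)).
        * intros; apply cond_pos_sum; intros; apply Hy0.
        * apply (is_series_sum y (fun m => Rabs (c m) * L ^ m)), HyS.
    - apply sum_le_series; [apply HcL|apply Series_correct, HZex]. }
  destruct (pos_series_bounded Q Z HQ0 HQsum) as [HQex HQZ].
  split; [exact HQex|]. split.
  { eapply Rle_trans; [exact HQZ|]. apply Series_le; assumption. }
  assert (Hqex : ex_series (comp_coef c x)).
  { apply ex_series_le_R with Q; [|exact HQex]. intros n. unfold comp_coef, Q.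
    eapply Rle_trans; [apply Rsum_abs|]. apply sum_Rle. intros; apply Hxy. }
  assert (Hdist : forall K, Rabs (Series (comp_coef c x) - sum_f_R0 (fun m => c m * l ^ m) K)
    <= Z - sum_f_R0 (fun m => Rabs (c m) * L ^ m) K).
  { intros K.
    pose proof (is_series_sum _ _ K HxS) as HS1.
    pose proof (is_series_sum _ _ K HyS) as HS2.
    pose proof (is_series_minus _ _ _ _ (Series_correct _ Hqex) HS1) as Hd.
    pose proof (is_series_minus _ _ _ _ (Series_correct _ HQex) HS2) as Hb.
    apply Rle_trans with (Series Q - sum_f_R0 (fun m => Rabs (c m) * L ^ m) K); [|lra].
    replace (Series (comp_coef c x) - sum_f_R0 (fun m => c m * l ^ m) K)
      with (Series (fun n => plus (comp_coef c x n) (opp (sum_f_R0 (fun m => c m * conv_pow x m n) K))))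
      by (apply is_series_unique, Hd).
    replace (Series Q - sum_f_R0 (fun m => Rabs (c m) * L ^ m) K)
      with (Series (fun n => plus (Q n) (opp (sum_f_R0 (fun m => y m n) K))))
      by (apply is_series_unique, Hb).
    assert (Hle : forall n, Rabs (plus (comp_coef c x n) (opp (sum_f_R0 (fun m => c m * conv_pow x m n) K)))
      <= plus (Q n) (opp (sum_f_R0 (fun m => y m n) K))).
    { intros n. unfold plus, opp; simpl.
      destruct (Nat.le_gt_cases n K) as [HnK|HnK].
      - rewrite (HQ n K HnK).
        replace (comp_coef c x n) with (sum_f_R0 (fun m => c m * conv_pow x m n) K).
        + rewrite !Rplus_opp_r, Rabs_R0. lra.
        + replace K with (n + (K - n))%nat by lia.
          apply (sum_zero_tail (fun m => c m * conv_pow x m n)). intros m Hm.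
          rewrite conv_pow_low by (assumption || lia). ring.
      - pose proof (sum_diff_bound (fun m => c m * conv_pow x m n) (fun m => y m n) K (n - K)
          (fun m => Hxy m n)) as Hd'.
        replace (K + (n - K))%nat with n in Hd' by lia. exact Hd'. }
    assert (Hex : ex_series (fun n => Rabs (plus (comp_coef c x n)
       (opp (sum_f_R0 (fun m => c m * conv_pow x m n) K))))).
    { eapply ex_series_le_R; [|eexists; exact Hb]. intros n.
      rewrite Rabs_Rabsolu. apply Hle. }
    eapply Rle_trans; [apply Series_Rabs, Hex|].
    apply Series_le; [|eexists; exact Hb].
    intros n. split; [apply Rabs_pos|apply Hle]. }
  assert (Hlim : is_series (fun m => c m * l ^ m) (Series (comp_coef c x))).
  { apply is_series_Reals. intros eps Heps.
    pose proof (proj1 (is_series_Reals _ _) (Series_correct _ HZex) eps Heps) as [K0 HK0].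
    exists K0. intros K HK. specialize (HK0 K HK). specialize (Hdist K).
    unfold Rdist in *. fold Z in HK0.
    rewrite Rabs_minus_sym. eapply Rle_lt_trans; [exact Hdist|].
    eapply Rle_lt_trans; [|exact HK0]. rewrite Rabs_minus_sym. apply Rle_abs. }
  rewrite (is_series_unique _ _ Hlim). apply Series_correct, Hqex.
Qed.

Lemma homogeneous_conv_pow (N : nat -> R) (p : nat -> R -> R -> R) m n :
  (forall n, homogeneous n (N n) (p n)) ->
  homogeneous n (conv_pow N m n) (fun h k => conv_pow (fun j => p j h k) m n).
Proof.
  intros H. revert n. induction m as [|m IH]; intros n; simpl.
  - destruct n.
    + apply (homogeneous_weaken _ _ _ _ _ (homogeneous_const 1)); intros; [rewrite Rabs_R1; lra|reflexivity].
    + apply homogeneous_zero.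
  - apply (homogeneous_sum n n (fun k => N k * conv_pow N m (n - k))
      (fun i h k => p i h k * conv_pow (fun j => p j h k) m (n - i))).
    intros i Hi. replace n with (i + (n - i))%nat at 1 by lia.
    apply (homogeneous_mult _ _ _ _ (p i) (fun h k => conv_pow (fun j => p j h k) m (n - i))); auto.
Qed.

Lemma homogeneous_comp_coef c (N : nat -> R) (p : nat -> R -> R -> R) n :
  (forall n, homogeneous n (N n) (p n)) ->
  homogeneous n (comp_coef (fun m => Rabs (c m)) N n) (fun h k => comp_coef c (fun j => p j h k) n).
Proof.
  intros H. apply (homogeneous_sum n n (fun m => Rabs (c m) * conv_pow N m n)
    (fun m h k => c m * conv_pow (fun j => p j h k) m n)).
  intros m _. apply (homogeneous_scal n _ (fun h k => conv_pow (fun j => p j h k) m n)).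
  apply homogeneous_conv_pow, H.
Qed.

Definition expansion1 (f : R -> R) (x : R) (a : nat -> R) (r : R) : Prop :=
  0 < r /\ ex_series (fun n => Rabs (a n) * r ^ n) /\
  forall h, Rabs h <= r -> is_series (fun n => a n * h ^ n) (f (x + h)).

Lemma analytic1_expansion f x :
  analytic1 f x <-> exists a r, expansion1 f x a r.
Proof.
  split.
  - intros [a H]. apply locally_R in H. destruct H as [e [He H]].
    exists a, (e / 4). repeat split; [lra| |].
    + apply ex_series_ext_R with (fun n => Rabs (a n * (e / 4) ^ n)).
      { intros n. rewrite Rabs_mult, (Rabs_pos_eq ((e / 4) ^ n)); [reflexivity|].
        apply pow_le; lra. }
      apply CV_disk_inside. apply Rbar_lt_le_trans with (e / 2).
      { simpl. rewrite Rabs_pos_eq; lra. }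
      apply Rbar_not_lt_le. intros Hlt.
      apply (CV_disk_outside a (e / 2)).
      { rewrite Rabs_pos_eq by lra. exact Hlt. }
      specialize (H (x + e / 2)). replace (x + e / 2 - x) with (e / 2) in H by ring.
      rewrite Rabs_pos_eq in H by lra. specialize (H ltac:(lra)).
      apply is_pseries_R in H. apply ex_series_lim_0. eexists; exact H.
    + intros h Hh. specialize (H (x + h)). replace (x + h - x) with h in H by ring.
      apply is_pseries_R, H. lra.
  - intros [a [r [Hr [_ H]]]]. exists a. apply locally_R. exists r. split; [exact Hr|].
    intros y Hy. apply is_pseries_R. replace (f y) with (f (x + (y - x))) by (f_equal; ring).
    apply H. lra.
Qed.

Lemma expansion2_shrink f s t N p r r' :
  0 < r' <= r -> expansion2 f s t N p r -> expansion2 f s t N p r'.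
Proof.
  intros [Hr' Hle] [Hr [Hp [HN Hs]]]. repeat split; auto.
  - apply ex_series_le_R with (fun n => N n * r ^ n); [|exact HN].
    intros n. pose proof (homogeneous_nonneg _ _ _ (Hp n)).
    rewrite Rabs_pos_eq by (apply Rmult_le_pos; [assumption|apply pow_le; lra]).
    apply Rmult_le_compat_l; [assumption|]. apply pow_incr; lra.
  - intros h k Hh Hk. apply Hs; lra.
Qed.

(** Without a constant term, shrinking the radius by a factor [q <= 1] shrinks
    the sum by at least that factor. *)
Lemma small_series (N : nat -> R) (r delta : R) :
  (forall n, 0 <= N n) -> N 0%nat = 0 -> 0 < r -> 0 < delta ->
  ex_series (fun n => N n * r ^ n) ->
  exists r', 0 < r' <= r /\ ex_series (fun n => N n * r' ^ n) /\
    Series (fun n => N n * r' ^ n) <= delta.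
Proof.
  intros HN HN0 Hr Hd Hex. set (S := Series (fun n => N n * r ^ n)).
  assert (HS : 0 <= S).
  { apply Rle_trans with (sum_f_R0 (fun n => N n * r ^ n) 0); [simpl; specialize (HN 0%nat); lra|].
    apply sum_le_series; [|apply Series_correct, Hex].
    intros n. apply Rmult_le_pos; auto. apply pow_le; lra. }
  (* [S + 1] in place of [S] keeps the quotient defined when the sum vanishes *)
  set (q := Rmin 1 (delta / (S + 1))).
  assert (Hdq : 0 < delta / (S + 1)) by (apply Rdiv_lt_0_compat; lra).
  assert (Hq : 0 < q <= 1).
  { split; [apply Rmin_glb_lt; lra|apply Rmin_l]. }
  assert (HqS : q * S <= delta).
  { apply Rle_trans with (delta / (S + 1) * (S + 1)).
    - apply Rmult_le_compat; try lra. apply Rmin_r.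
    - field_simplify; lra. }
  assert (Hterm : forall n, 0 <= N n * (q * r) ^ n <= q * (N n * r ^ n)).
  { intros n. split.
    - apply Rmult_le_pos; auto. apply pow_le. nra.
    - destruct n as [|n]; [rewrite HN0; lra|].
      rewrite Rpow_mult_distr. simpl.
      replace (q * (N (Datatypes.S n) * (r * r ^ n)))
        with (q * 1 * (N (Datatypes.S n) * (r * r ^ n))) by ring.
      replace (N (Datatypes.S n) * (q * q ^ n * (r * r ^ n)))
        with (q * q ^ n * (N (Datatypes.S n) * (r * r ^ n))) by ring.
      apply Rmult_le_compat_r.
      + apply Rmult_le_pos; auto. apply Rmult_le_pos; [lra|apply pow_le; lra].
      + apply Rmult_le_compat_l; [lra|]. rewrite <- (pow1 n). apply pow_incr; lra. }
  assert (Hexq : ex_series (fun n => q * (N n * r ^ n))).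
  { exact (ex_series_scal q _ Hex). }
  exists (q * r). split; [nra|]. split.
  - apply ex_series_le_R with (fun n => q * (N n * r ^ n)); [|exact Hexq].
    intros n. rewrite Rabs_pos_eq; apply Hterm.
  - eapply Rle_trans; [apply Series_le; [exact Hterm|exact Hexq]|].
    rewrite Series_scal_l. exact HqS.
Qed.

(** Remove the constant term of [f], shrink the square until the remaining
    dominating series is at most a radius [d] at which the series of [phi]
    converges absolutely, and apply [comp_coef_series] at each point of the square. *)
Theorem analytic2_comp (phi : R -> R) (f : R -> R -> R) s t :
  analytic1 phi (f s t) -> analytic2 f s t -> analytic2 (fun x y => phi (f x y)) s t.
Proof.
  intros Hphi Hf.
  apply analytic1_expansion in Hphi. destruct Hphi as [c [d [Hd [Hc Hphi]]]].
  apply analytic2_expansion in Hf. destruct Hf as [N [p [r HE]]].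
  set (N' := fun n => match n with O => 0 | S _ => N n end).
  set (p' := fun n => match n with O => fun _ _ => 0 | S _ => p n end).
  assert (Hp' : forall n, homogeneous n (N' n) (p' n)).
  { intros [|n]; simpl; [apply homogeneous_zero|]. destruct HE as [_ [H _]]. apply H. }
  assert (HN' : forall n, 0 <= N' n) by (intros n; eapply homogeneous_nonneg, Hp').
  pose proof HE as [Hr [Hp [HN Hs]]].
  assert (Hex : ex_series (fun n => N' n * r ^ n)).
  { apply ex_series_le_R with (fun n => N n * r ^ n); [|exact HN].
    intros n. rewrite Rabs_pos_eq by (apply Rmult_le_pos; [auto|apply pow_le; lra]).
    apply Rmult_le_compat_r; [apply pow_le; lra|]. destruct n; simpl; [|lra].
    eapply homogeneous_nonneg, Hp. }
  destruct (small_series N' r d HN' eq_refl Hr Hd Hex) as [r' [Hr' [Hex' Hsum]]].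
  destruct (expansion2_shrink _ _ _ _ _ _ _ Hr' HE) as [_ [_ [_ Hs']]].
  assert (Hval : forall h k, Rabs h <= r' -> Rabs k <= r' ->
    is_series (fun n => p' n h k) (f (s + h) (t + k) - f s t)).
  { intros h k Hh Hk.
    assert (H0 : p 0%nat h k = f s t).
    { assert (Hz : Rabs 0 <= r') by (rewrite Rabs_R0; lra).
      pose proof (Hs' 0 0 Hz Hz) as H0. rewrite !Rplus_0_r in H0.
      destruct (homogeneous_coef _ _ _ (Hp 0%nat)) as [c0 [Hc0 _]].
      rewrite <- (is_series_unique _ _ H0), Hc0. simpl.
      transitivity (p 0%nat 0 0); [rewrite Hc0; simpl; ring|].
      symmetry. apply is_series_unique.
      apply (is_series_constant_term (fun n => p n 0 0)). intros n.
      pose proof (homogeneous_bound _ _ _ 0 0 0 (Hp (S n))) as Hb.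
      rewrite Rabs_R0 in Hb. specialize (Hb (Rle_refl 0) (Rle_refl 0)).
      rewrite pow_ne_zero, Rmult_0_r in Hb by lia.
      apply Rabs_eq_0, Rle_antisym; [exact Hb|apply Rabs_pos]. }
    rewrite <- H0.
    pose proof (Hs' h k Hh Hk) as H.
    pose proof (is_series_minus _ _ _ _ H (is_series_constant_term
      (fun n => match n with O => p 0%nat h k | S _ => 0 end) (fun n => eq_refl))) as Hm.
    revert Hm. apply is_series_ext_R. intros [|n]; unfold plus, opp; simpl; ring. }
  apply analytic2_expansion.
  exists (comp_coef (fun m => Rabs (c m)) N'),
    (fun n h k => comp_coef c (fun j => p' j h k) n), r'.
  assert (HX0 : N' 0%nat * r' ^ 0 = 0) by (simpl; ring).
  assert (Hbound : forall h k, Rabs h <= r' -> Rabs k <= r' ->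
     forall n, Rabs (p' n h k) <= N' n * r' ^ n).
  { intros h k Hh Hk n. apply homogeneous_bound; auto. }
  repeat split; [apply Hr'| | |].
  - intros n. apply homogeneous_comp_coef, Hp'.
  - assert (Hz : Rabs 0 <= r') by (rewrite Rabs_R0; lra).
    destruct (comp_coef_series c _ _ d HX0 (Hbound 0 0 Hz Hz) Hex' Hsum Hc) as [H _].
    revert H. apply ex_series_ext_R. intros n. apply comp_coef_scale.
  - intros h k Hh Hk.
    destruct (comp_coef_series c _ _ d HX0 (Hbound h k Hh Hk) Hex' Hsum Hc) as [_ [_ H]].
    rewrite (is_series_unique _ _ (Hval h k Hh Hk)) in H.
    assert (Hsmall : Rabs (f (s + h) (t + k) - f s t) <= d).
    { rewrite <- (is_series_unique _ _ (Hval h k Hh Hk)).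
      assert (Hex2 : ex_series (fun n => Rabs (p' n h k))).
      { apply ex_series_le_R with (fun n => N' n * r' ^ n); [|exact Hex'].
        intros; rewrite Rabs_Rabsolu; auto. }
      eapply Rle_trans; [apply Series_Rabs, Hex2|].
      eapply Rle_trans; [|exact Hsum]. apply Series_le; [|exact Hex'].
      intros n. split; [apply Rabs_pos|auto]. }
    pose proof (Hphi _ Hsmall) as Hv. rewrite (is_series_unique _ _ Hv) in H.
    replace (f s t + (f (s + h) (t + k) - f s t)) with (f (s + h) (t + k)) in H by ring.
    exact H.
Qed.

(** * Closure properties of analytic functions *)

Lemma analytic2_ext_loc f g s t :
  locally ((s, t) : R * R) (fun z => f (fst z) (snd z) = g (fst z) (snd z)) ->
  analytic2 f s t -> analytic2 g s t.
Proof.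
  intros H [a Ha]. exists a. generalize (filter_and _ _ H Ha).
  apply filter_imp. intros z [Hz [H1 H2]]. split; [exact H1|]. rewrite <- Hz. exact H2.
Qed.

Lemma analytic2_ext f g s t :
  (forall x y, f x y = g x y) -> analytic2 f s t -> analytic2 g s t.
Proof. intros H. apply analytic2_ext_loc. apply filter_forall. intros; apply H. Qed.

Lemma analytic2_const c s t : analytic2 (fun _ _ => c) s t.
Proof.
  apply analytic2_expansion.
  exists (fun n => match n with O => Rabs c | S _ => 0 end),
    (fun n _ _ => match n with O => c | S _ => 0 end), 1.
  repeat split; [lra| | |].
  - intros [|n]; [apply homogeneous_const|apply homogeneous_zero].
  - eexists. apply (is_series_constant_term
      (fun n => match n with O => Rabs c | S _ => 0 end * 1 ^ n)). intros; ring.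
  - intros h k _ _.
    apply (is_series_constant_term (fun n => match n with O => c | S _ => 0 end)). reflexivity.
Qed.

Lemma expansion2_common f g s t : analytic2 f s t -> analytic2 g s t ->
  exists N p M q r, expansion2 f s t N p r /\ expansion2 g s t M q r.
Proof.
  intros Hf Hg. apply analytic2_expansion in Hf. apply analytic2_expansion in Hg.
  destruct Hf as [N [p [r Hf]]]. destruct Hg as [M [q [r' Hg]]].
  pose proof (proj1 Hf). pose proof (proj1 Hg).
  exists N, p, M, q, (Rmin r r').
  split; eapply expansion2_shrink; [|exact Hf| |exact Hg]; split;
    auto using Rmin_l, Rmin_r, Rmin_glb_lt.
Qed.

Lemma analytic2_plus f g s t :
  analytic2 f s t -> analytic2 g s t -> analytic2 (fun x y => f x y + g x y) s t.
Proof.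
  intros Hf Hg. destruct (expansion2_common f g s t Hf Hg)
    as [N [p [M [q [r [[Hr [Hp [HN Hfs]]] [_ [Hq [HM Hgs]]]]]]]]].
  apply analytic2_expansion.
  exists (fun n => N n + M n), (fun n h k => p n h k + q n h k), r.
  repeat split; [exact Hr| | |].
  - intros n. apply homogeneous_add; auto.
  - apply ex_series_ext_R with (fun n => N n * r ^ n + M n * r ^ n); [intros; ring|].
    exact (ex_series_plus _ _ HN HM).
  - intros h k Hh Hk. exact (is_series_plus _ _ _ _ (Hfs h k Hh Hk) (Hgs h k Hh Hk)).
Qed.

Lemma analytic2_mult f g s t :
  analytic2 f s t -> analytic2 g s t -> analytic2 (fun x y => f x y * g x y) s t.
Proof.
  intros Hf Hg. destruct (expansion2_common f g s t Hf Hg)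
    as [N [p [M [q [r [[Hr [Hp [HN Hfs]]] [_ [Hq [HM Hgs]]]]]]]]].
  assert (Habs : forall (K : nat -> R) (l : nat -> R -> R -> R),
    (forall n, homogeneous n (K n) (l n)) -> ex_series (fun n => K n * r ^ n) ->
    ex_series (fun n => Rabs (K n * r ^ n))).
  { intros K l Hl. apply ex_series_ext_R. intros n. apply eq_sym, Rabs_pos_eq.
    apply Rmult_le_pos; [eapply homogeneous_nonneg, Hl|apply pow_le; lra]. }
  apply analytic2_expansion.
  exists (PS_mult N M), (fun n h k => PS_mult (fun j => p j h k) (fun j => q j h k) n), r.
  repeat split; [exact Hr| | |].
  - intros n. apply (homogeneous_sum n n (fun k => N k * M (n - k)%nat)
      (fun i h k => p i h k * q (n - i)%nat h k)).
    intros i Hi. pose proof (homogeneous_mult _ _ _ _ _ _ (Hp i) (Hq (n - i)%nat)) as H.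
    replace (i + (n - i))%nat with n in H by lia. exact H.
  - eexists. apply (is_series_ext_R (PS_mult (fun n => N n * r ^ n) (fun n => M n * r ^ n))).
    + intros n. unfold PS_mult. rewrite (Rmult_comm _ (r ^ n)), scal_sum.
      apply sum_eq. intros i Hi.
      replace (r ^ n) with (r ^ i * r ^ (n - i)) by (rewrite <- pow_add; f_equal; lia). ring.
    + apply is_series_mult; eauto using Series_correct.
  - intros h k Hh Hk.
    assert (Hle : forall (K : nat -> R) (l : nat -> R -> R -> R),
      (forall n, homogeneous n (K n) (l n)) -> ex_series (fun n => K n * r ^ n) ->
      ex_series (fun n => Rabs (l n h k))).
    { intros K l Hl. apply ex_series_le_R. intros n. rewrite Rabs_Rabsolu.
      apply homogeneous_bound; auto. }
    apply is_series_mult; eauto.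
Qed.

Lemma analytic2_linear (l : R -> R -> R) (B s t : R) :
  homogeneous 1 B l -> analytic2 (fun x y => l (x - s) (y - t)) s t.
Proof.
  intros Hl. apply analytic2_expansion.
  exists (fun n => match n with 1%nat => B | _ => 0 end),
    (fun n => match n with 1%nat => l | _ => fun _ _ => 0 end), 1.
  repeat split; [lra| | |].
  - intros [|[|n]]; auto using homogeneous_zero.
  - eexists. apply (is_series_finite _ 1). intros [|[|n]] Hn; lia || ring.
  - intros h k _ _. replace (s + h - s) with h by ring. replace (t + k - t) with k by ring.
    replace (l h k) with (sum_f_R0
      (fun n => match n with 1%nat => l | _ => fun _ _ : R => 0 end h k) 1) by (simpl; ring).
    apply (is_series_finite _ 1). intros [|[|n]] Hn; lia || reflexivity.
Qed.

Lemma analytic2_fst s t : analytic2 (fun x _ => x) s t.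
Proof.
  apply analytic2_ext with (fun x y => s + (x - s)); [intros; ring|].
  apply analytic2_plus; [apply analytic2_const|].
  apply (analytic2_linear (fun h _ => h) (Rabs 1)).
  apply (homogeneous_weaken _ _ _ _ _ (homogeneous_fst _ _ _ (homogeneous_const 1))); intros; ring || lra.
Qed.

Lemma analytic2_snd s t : analytic2 (fun _ y => y) s t.
Proof.
  apply analytic2_ext with (fun x y => t + (y - t)); [intros; ring|].
  apply analytic2_plus; [apply analytic2_const|].
  apply (analytic2_linear (fun _ k => k) (Rabs 1)).
  apply (homogeneous_weaken _ _ _ _ _ (homogeneous_snd _ _ _ (homogeneous_const 1))); intros; ring || lra.
Qed.

Lemma analytic2_scal c f s t : analytic2 f s t -> analytic2 (fun x y => c * f x y) s t.
Proof. apply (analytic2_mult (fun _ _ => c)), analytic2_const. Qed.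

Lemma analytic2_opp f s t : analytic2 f s t -> analytic2 (fun x y => - f x y) s t.
Proof.
  intros Hf. apply analytic2_ext with (fun x y => (-1) * f x y); [intros; ring|].
  apply analytic2_scal, Hf.
Qed.

Lemma analytic2_minus f g s t :
  analytic2 f s t -> analytic2 g s t -> analytic2 (fun x y => f x y - g x y) s t.
Proof. intros Hf Hg. apply analytic2_plus; [exact Hf|apply analytic2_opp, Hg]. Qed.

Lemma analytic2_translate f s0 t0 s t :
  analytic2 f (s + s0) (t + t0) -> analytic2 (fun x y => f (x + s0) (y + t0)) s t.
Proof.
  intros H. apply analytic2_expansion in H. destruct H as [N [p [r [Hr [Hp [HN H]]]]]].
  apply analytic2_expansion. exists N, p, r. repeat split; auto.
  intros h k Hh Hk. replace (s + h + s0) with (s + s0 + h) by ring.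
  replace (t + k + t0) with (t + t0 + k) by ring. auto.
Qed.

Lemma analytic1_ext_loc f g x :
  locally x (fun y => f y = g y) -> analytic1 f x -> analytic1 g x.
Proof.
  intros H [a Ha]. exists a. generalize (filter_and _ _ H Ha).
  apply filter_imp. intros y [Hy H1]. rewrite <- Hy. exact H1.
Qed.

Lemma analytic1_id x : analytic1 (fun y => y) x.
Proof.
  apply analytic1_expansion. exists (fun n => match n with O => x | 1%nat => 1 | _ => 0 end), 1.
  repeat split; [lra| |].
  - eexists. apply (is_series_finite _ 1). intros [|[|n]] Hn; [lia|lia|].
    rewrite Rabs_R0. ring.
  - intros h _. replace (x + h) with (sum_f_R0
      (fun n => match n with O => x | 1%nat => 1 | _ => 0 end * h ^ n) 1) by (simpl; ring).
    apply (is_series_finite _ 1). intros [|[|n]] Hn; lia || ring.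
Qed.

(** Together with [analytic2_restrict] this transfers closure properties from
    two variables to one. *)
Lemma analytic2_of_snd f s t : analytic1 f t -> analytic2 (fun _ y => f y) s t.
Proof. intros H. apply (analytic2_comp f (fun _ y => y)); [exact H|apply analytic2_snd]. Qed.

Lemma analytic2_restrict f s t : analytic2 f s t -> analytic1 (f s) t.
Proof.
  intros [a Ha]. exists (fun n => a 0%nat n). apply locally_prod in Ha.
  destruct Ha as [r [Hr Ha]]. apply locally_R. exists r. split; [exact Hr|].
  intros y Hy. destruct (Ha s y) as [_ H]; [rewrite Rminus_diag, Rabs_R0; exact Hr|exact Hy|].
  cbn [fst snd] in H. apply is_pseries_R. revert H. apply is_series_ext_R. intros n.
  rewrite sum_n_Reals, Rminus_diag. replace n with (0 + n)%nat at 1 by lia.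
  rewrite (sum_zero_tail (fun i => a i (n - i)%nat * 0 ^ i * (y - t) ^ (n - i))).
  - simpl. rewrite Nat.sub_0_r. ring.
  - intros m Hm. rewrite pow_ne_zero by lia. ring.
Qed.

Lemma analytic1_comp f g x : analytic1 f (g x) -> analytic1 g x -> analytic1 (fun y => f (g y)) x.
Proof.
  intros Hf Hg. apply (analytic2_restrict (fun _ y => f (g y)) 0).
  apply (analytic2_comp f (fun _ y => g y)); [exact Hf|apply analytic2_of_snd, Hg].
Qed.

Lemma analytic1_plus f g x : analytic1 f x -> analytic1 g x -> analytic1 (fun y => f y + g y) x.
Proof.
  intros Hf Hg. apply (analytic2_restrict (fun _ y => f y + g y) 0).
  apply analytic2_plus; apply analytic2_of_snd; assumption.
Qed.

Lemma analytic1_mult f g x : analytic1 f x -> analytic1 g x -> analytic1 (fun y => f y * g y) x.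
Proof.
  intros Hf Hg. apply (analytic2_restrict (fun _ y => f y * g y) 0).
  apply analytic2_mult; apply analytic2_of_snd; assumption.
Qed.

Lemma analytic1_const c x : analytic1 (fun _ => c) x.
Proof. apply (analytic2_restrict (fun _ _ => c) 0), analytic2_const. Qed.

Lemma analytic1_inv x : x <> 0 -> analytic1 Rinv x.
Proof.
  intros Hx. pose proof (Rabs_pos_lt x Hx) as Hax. apply analytic1_expansion.
  assert (Hpow : forall h n, (- / x) ^ n * / x * h ^ n = / x * (- h / x) ^ n).
  { intros h n. unfold Rdiv. replace (- h * / x) with (- / x * h) by ring.
    rewrite Rpow_mult_distr. ring. }
  assert (Hgeom : forall h, Rabs h <= Rabs x / 2 -> Rabs (- h / x) < 1).
  { intros h Hh. unfold Rdiv. rewrite Rabs_mult, Rabs_Ropp, Rabs_inv.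
    apply Rmult_lt_reg_r with (Rabs x); [exact Hax|]. field_simplify; lra. }
  exists (fun n => (- / x) ^ n * / x), (Rabs x / 2). repeat split; [lra| |].
  - apply ex_series_ext_R with (fun n => / Rabs x * (/ 2) ^ n).
    + intros n. rewrite Rabs_mult, <- RPow_abs, Rabs_Ropp, Rabs_inv.
      replace (/ 2) with (/ Rabs x * (Rabs x / 2)) by (field; lra).
      rewrite Rpow_mult_distr. ring.
    + eexists. apply is_series_scal_R, is_series_geom. rewrite Rabs_pos_eq; lra.
  - intros h Hh. apply is_series_ext_R with (fun n => / x * (- h / x) ^ n).
    { intros n. symmetry. apply Hpow. }
    assert (Hxh : x + h <> 0).
    { intros H0. replace h with (- x) in Hh by lra. rewrite Rabs_Ropp in Hh. lra. }
    replace (/ (x + h)) with (/ x * / (1 - (- h / x))).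
    + apply is_series_scal_R, is_series_geom, Hgeom, Hh.
    + field. repeat split; try assumption; intros H0; apply Hxh; lra.
Qed.

Lemma analytic2_inv f s t : analytic2 f s t -> f s t <> 0 -> analytic2 (fun x y => / f x y) s t.
Proof. intros Hf H. apply (analytic2_comp Rinv f); [apply analytic1_inv, H|exact Hf]. Qed.

Lemma analytic2_div f g s t : analytic2 f s t -> analytic2 g s t -> g s t <> 0 ->
  analytic2 (fun x y => f x y / g x y) s t.
Proof. intros Hf Hg H. apply analytic2_mult; [exact Hf|apply analytic2_inv; assumption]. Qed.

Lemma analytic1_PSeries f x b (r : R) :
  0 < r -> Rbar_le r (CV_radius b) ->
  (forall h, Rabs h < r -> f (x + h) = PSeries b h) -> analytic1 f x.
Proof.
  intros Hr Hb H. exists b. apply locally_R. exists r. split; [exact Hr|].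
  intros y Hy. replace (f y) with (PSeries b (y - x)).
  - apply PSeries_correct, CV_radius_inside.
    apply Rbar_lt_le_trans with r; [exact Hy|exact Hb].
  - rewrite <- H by exact Hy. f_equal; ring.
Qed.

Lemma expansion1_radius f x b r : expansion1 f x b r ->
  Rbar_le r (CV_radius b) /\ forall h, Rabs h < r -> f (x + h) = PSeries b h.
Proof.
  intros [Hr [Hex H]]. split.
  - apply Rbar_not_lt_le. intros Hlt. apply (CV_disk_outside b r).
    { rewrite Rabs_pos_eq by lra. exact Hlt. }
    apply ex_series_lim_0. eexists. apply H. rewrite Rabs_pos_eq; lra.
  - intros h Hh. symmetry. apply is_series_unique.
    specialize (H h ltac:(lra)). revert H. apply is_series_ext_R. intros; reflexivity.
Qed.

Lemma analytic1_radius f x : analytic1 f x -> exists b (r : R),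
  0 < r /\ Rbar_le r (CV_radius b) /\ forall h, Rabs h < r -> f (x + h) = PSeries b h.
Proof.
  intros H. apply analytic1_expansion in H. destruct H as [b [r H]].
  exists b, r. split; [apply H|apply expansion1_radius, H].
Qed.

Lemma analytic1_is_derive f x b (r h : R) :
  Rbar_le r (CV_radius b) ->
  (forall h, Rabs h < r -> f (x + h) = PSeries b h) ->
  Rabs h < r -> is_derive f (x + h) (PSeries (PS_derive b) h).
Proof.
  intros Hb H Hh.
  apply is_derive_ext_loc with (fun y => PSeries b (y - x)).
  - apply locally_R. exists (r - Rabs h). split; [lra|]. intros y Hy.
    rewrite <- H; [f_equal; ring|].
    replace (y - x) with (h + (y - (x + h))) by ring.
    eapply Rle_lt_trans; [apply Rabs_triang|]. lra.
  - replace (PSeries (PS_derive b) h) with (scal 1 (PSeries (PS_derive b) (x + h - x)))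
      by (unfold scal; simpl; unfold mult; simpl; rewrite Rmult_1_l; f_equal; ring).
    apply (is_derive_comp (PSeries b) (fun y => y - x)).
    + apply is_derive_PSeries. replace (x + h - x) with h by ring.
      apply Rbar_lt_le_trans with r; [exact Hh|exact Hb].
    + auto_derive; [exact I|ring].
Qed.

Lemma expansion1_coef f x b r :
  expansion1 f x b r -> f x = b 0%nat /\ Derive f x = b 1%nat.
Proof.
  intros H. destruct (expansion1_radius f x b r H) as [Hb Hf].
  assert (Hz : Rabs 0 < r) by (rewrite Rabs_R0; apply H). split.
  - specialize (Hf 0 Hz). rewrite Rplus_0_r, PSeries_0 in Hf. exact Hf.
  - apply is_derive_unique.
    pose proof (analytic1_is_derive f x b r 0 Hb Hf Hz) as Hd.
    rewrite Rplus_0_r, PSeries_0 in Hd. unfold PS_derive in Hd.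
    rewrite Rmult_1_l in Hd. exact Hd.
Qed.

Lemma analytic1_ex_derive f x : analytic1 f x -> ex_derive f x.
Proof.
  intros H. destruct (analytic1_radius f x H) as [b [r [Hr [Hb Hf]]]].
  exists (PSeries (PS_derive b) 0). replace x with (x + 0) by ring.
  apply (analytic1_is_derive f x b r); auto. rewrite Rabs_R0; exact Hr.
Qed.

Lemma analytic1_Derive f x : analytic1 f x -> analytic1 (Derive f) x.
Proof.
  intros H. destruct (analytic1_radius f x H) as [b [r [Hr [Hb Hf]]]].
  apply (analytic1_PSeries _ x (PS_derive b) r); [exact Hr|rewrite CV_radius_derive; exact Hb|].
  intros h Hh. apply is_derive_unique. apply (analytic1_is_derive f x b r); auto.
Qed.

Lemma analytic1_has_primitive g x : analytic1 g x ->
  exists P d, 0 < d /\ P x = 0 /\ analytic1 P x /\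
    forall y, Rabs (y - x) < d -> is_derive P y (g y).
Proof.
  intros H. destruct (analytic1_radius g x H) as [b [r [Hr [Hb Hg]]]].
  set (P := fun y => PSeries (PS_Int b) (y - x)).
  assert (HPS : forall h, Rabs h < r -> P (x + h) = PSeries (PS_Int b) h).
  { intros h _. unfold P. f_equal; ring. }
  assert (HCV : Rbar_le r (CV_radius (PS_Int b))) by (rewrite CV_radius_Int; exact Hb).
  exists P, r. split; [exact Hr|split; [|split]].
  - unfold P. rewrite Rminus_diag, PSeries_0. reflexivity.
  - exact (analytic1_PSeries P x (PS_Int b) r Hr HCV HPS).
  - intros y Hy. pose proof (analytic1_is_derive P x (PS_Int b) r (y - x) HCV HPS Hy) as Hd.
    rewrite (PSeries_ext _ b) in Hd.
    + rewrite <- Hg in Hd by exact Hy. replace (x + (y - x)) with y in Hd by ring. exact Hd.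
    + intros n. unfold PS_derive, PS_Int. field. apply not_0_INR; lia.
Qed.

(** The primitive of the power series of [g] differs from [f] by a constant. *)
Lemma analytic1_primitive f g x :
  locally x (fun y => is_derive f y (g y)) -> analytic1 g x -> analytic1 f x.
Proof.
  intros Hd H. destruct (analytic1_has_primitive g x H) as [P [r [Hr [_ [HPan HP]]]]].
  apply locally_R in Hd. destruct Hd as [e [He Hd]].
  apply analytic1_ext_loc with (fun y => P y + (f x - P x)).
  - apply locally_R. exists (Rmin r e). split; [apply Rmin_glb_lt; assumption|].
    intros y Hy. pose proof (Rmin_l r e). pose proof (Rmin_r r e).
    destruct (MVT_cor4 (fun y => f y - P y) (fun _ => 0) x (Rabs (y - x))) with (b := y)
      as [c [Hc _]].
    + intros c Hc. replace 0 with (minus (g c) (g c)) by apply (minus_eq_zero (g c)).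
      apply @is_derive_minus; [apply Hd|apply HP]; lra.
    + lra.
    + lra.
  - apply analytic1_plus; [exact HPan|apply analytic1_const].
Qed.

Lemma analytic1_translate f x c : analytic1 f (x - c) -> analytic1 (fun y => f (y - c)) x.
Proof.
  intros H. apply (analytic1_comp f (fun y => y - c)); [exact H|].
  apply analytic1_plus; [apply analytic1_id|apply analytic1_const].
Qed.

Lemma analytic1_cos_sin_0 : analytic1 cos 0 /\ analytic1 sin 0.
Proof.
  assert (Hzero : forall y, is_pseries (fun _ => 0) y 0).
  { intros y. apply is_pseries_R.
    apply (is_series_ext_R (fun _ => 0)); [intros; simpl; ring|].
    apply (is_series_constant_term (fun _ => 0)). reflexivity. }
  assert (Hp : forall u y l, infinite_sum (fun n => u n * y ^ n) l -> is_pseries u y l).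
  { intros u y l Hu. apply is_pseries_R, is_series_Reals, Hu. }
  split.
  - exists (fun n => if Nat.even n then cos_n (Nat.div2 n) else 0).
    apply filter_forall. intros y. rewrite Rminus_0_r.
    unfold cos. destruct (exist_cos (Rsqr y)) as [l Hl].
    replace l with (l + y * 0) by ring. apply is_pseries_odd_even.
    + apply is_pseries_ext with cos_n.
      { intros n. rewrite Nat.even_even, Nat.div2_double. reflexivity. }
      rewrite <- Rsqr_pow2. apply Hp, Hl.
    + apply is_pseries_ext with (fun _ => 0); [|apply Hzero].
      intros n. rewrite Nat.even_odd. reflexivity.
  - exists (fun n => if Nat.even n then 0 else sin_n (Nat.div2 n)).
    apply filter_forall. intros y. rewrite Rminus_0_r.
    unfold sin. destruct (exist_sin (Rsqr y)) as [l Hl].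
    replace (y * l) with (0 + y * l) by ring. apply is_pseries_odd_even.
    + apply is_pseries_ext with (fun _ => 0); [|apply Hzero].
      intros n. rewrite Nat.even_even. reflexivity.
    + apply is_pseries_ext with sin_n.
      { intros n. rewrite Nat.even_odd, Nat.add_1_r, Nat.div2_succ_double. reflexivity. }
      rewrite <- Rsqr_pow2. apply Hp, Hl.
Qed.

(** The addition formulas reduce the expansion at [x] to those at [0]. *)
Lemma analytic1_cos_sin x : analytic1 cos x /\ analytic1 sin x.
Proof.
  destruct analytic1_cos_sin_0 as [Hc Hs].
  assert (Hc' : analytic1 (fun y => cos (y - x)) x).
  { apply analytic1_translate. rewrite Rminus_diag. exact Hc. }
  assert (Hs' : analytic1 (fun y => sin (y - x)) x).
  { apply analytic1_translate. rewrite Rminus_diag. exact Hs. }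
  split.
  - apply analytic1_ext_loc with (fun y => cos x * cos (y - x) + (- sin x) * sin (y - x)).
    + apply filter_forall. intros y. replace (cos y) with (cos (x + (y - x))) by (f_equal; ring).
      rewrite cos_plus. ring.
    + apply analytic1_plus; apply analytic1_mult; auto using analytic1_const.
  - apply analytic1_ext_loc with (fun y => sin x * cos (y - x) + cos x * sin (y - x)).
    + apply filter_forall. intros y. replace (sin y) with (sin (x + (y - x))) by (f_equal; ring).
      rewrite sin_plus. ring.
    + apply analytic1_plus; apply analytic1_mult; auto using analytic1_const.
Qed.

Lemma analytic1_atan x : analytic1 atan x.
Proof.
  apply analytic1_primitive with (fun y => / (1 + y * y)).
  - apply filter_forall. intros y. apply is_derive_atan.
  - apply (analytic1_comp Rinv (fun y => 1 + y * y)).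
    + apply analytic1_inv. nra.
    + apply analytic1_plus; [apply analytic1_const|].
      apply analytic1_mult; apply analytic1_id.
Qed.

(** * Analytic local inverses *)

Lemma conv_pow_1 x n : conv_pow x 1 n = x n.
Proof.
  simpl. unfold PS_mult. destruct n as [|n]; [simpl; ring|].
  rewrite tech5, Nat.sub_diag, Rmult_1_r.
  rewrite (sum_eq_R0 _ n); [ring|].
  intros k Hk. replace (S n - k)%nat with (S (n - k)) by lia. ring.
Qed.

Definition degree_ge2 (g : nat -> R) (m : nat) : R :=
  match m with S (S _) => g m | _ => 0 end.

Lemma comp_coef_degree_ge2_ext g x y n :
  x 0%nat = 0 -> y 0%nat = 0 -> (forall k, (k < n)%nat -> x k = y k) ->
  comp_coef (degree_ge2 g) x n = comp_coef (degree_ge2 g) y n.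
Proof.
  intros Hx Hy H. apply sum_eq. intros [|[|m]] _; [simpl; ring|simpl; ring|].
  f_equal. apply conv_pow_ext_lt; assumption.
Qed.

Lemma comp_coef_split_linear g x n : x 0%nat = 0 ->
  comp_coef g x n = (match n with O => g 0%nat | S _ => 0 end) + g 1%nat * x n
    + comp_coef (degree_ge2 g) x n.
Proof.
  intros Hx. destruct n as [|n].
  - unfold comp_coef. simpl. rewrite Hx. ring.
  - assert (H : comp_coef g x (S n) - comp_coef (degree_ge2 g) x (S n)
      = sum_f_R0 (fun m => (g m - degree_ge2 g m) * conv_pow x m (S n)) (1 + n)).
    { unfold comp_coef. rewrite <- minus_sum. apply sum_eq. intros; ring. }
    rewrite sum_zero_tail in H.
    + cbn [sum_f_R0 degree_ge2] in H. rewrite conv_pow_1 in H. cbn [conv_pow] in H. lra.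
    + intros [|[|m]] Hm; [lia|lia|]. simpl degree_ge2. ring.
Qed.

Section FormalInverse.
Variable g : nat -> R.
Hypothesis g1 : g 1%nat <> 0.

(** The equation [g0 + g1 b + (terms of degree at least 2 in b) = g0 + x],
    solved for the linear term. By [conv_pow_ext_lt] each application fixes
    one more coefficient, so the iterates stabilize degree by degree. *)
Definition inverse_step (b : nat -> R) (n : nat) : R :=
  ((match n with 1%nat => 1 | _ => 0 end) - comp_coef (degree_ge2 g) b n) / g 1%nat.

Definition inverse_approx (K : nat) : nat -> R := Nat.iter K inverse_step (fun _ => 0).
Definition inverse_coef (n : nat) : R := inverse_approx n n.

Lemma inverse_approx_0 K : inverse_approx K 0 = 0.
Proof.
  destruct K; [reflexivity|]. simpl. unfold inverse_step, comp_coef. simpl.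
  field. exact g1.
Qed.

Lemma inverse_approx_S K n : (n <= K)%nat -> inverse_approx (S K) n = inverse_approx K n.
Proof.
  revert n. induction K as [|K IH]; intros n Hn.
  - replace n with 0%nat by lia. rewrite !inverse_approx_0. reflexivity.
  - change (inverse_step (inverse_approx (S K)) n = inverse_step (inverse_approx K) n).
    unfold inverse_step. rewrite (comp_coef_degree_ge2_ext g _ (inverse_approx K));
      auto using inverse_approx_0.
    intros k Hk. apply IH. lia.
Qed.

Lemma inverse_approx_coef K n : (n <= K)%nat -> inverse_approx K n = inverse_coef n.
Proof.
  intros Hn. replace K with (n + (K - n))%nat by lia.
  induction (K - n)%nat as [|j IH]; [rewrite Nat.add_0_r; reflexivity|].
  rewrite Nat.add_succ_r, inverse_approx_S by lia. exact IH.
Qed.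

Lemma inverse_coef_0 : inverse_coef 0 = 0.
Proof. apply inverse_approx_0. Qed.

(** The iterate [n] already agrees with the limit in all degrees up to [n],
    which are the only ones that matter for the coefficient [n] of the next
    iterate. *)
Lemma inverse_coef_fix n : inverse_step inverse_coef n = inverse_coef n.
Proof.
  rewrite <- (inverse_approx_coef (S n) n) by lia.
  change (inverse_approx (S n) n) with (inverse_step (inverse_approx n) n).
  unfold inverse_step. rewrite (comp_coef_degree_ge2_ext g _ (inverse_approx n));
    auto using inverse_approx_0, inverse_coef_0.
  intros k Hk. symmetry. apply inverse_approx_coef. lia.
Qed.

Lemma comp_coef_inverse n :
  comp_coef g inverse_coef n =
  match n with O => g 0%nat | 1%nat => 1 | _ => 0 end.
Proof.
  rewrite comp_coef_split_linear by apply inverse_coef_0.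
  rewrite <- (inverse_coef_fix n) at 1. unfold inverse_step.
  destruct n as [|[|n]]; field; exact g1.
Qed.

Variables delta r : R.
Hypothesis delta_pos : 0 < delta.
Hypothesis tail_ex : ex_series (fun m => Rabs (degree_ge2 g m) * delta ^ m).
Hypothesis tail_small :
  Series (fun m => Rabs (degree_ge2 g m) * delta ^ m) <= delta * (Rabs (g 1%nat) / 2).
Hypothesis r_pos : 0 < r.
Hypothesis r_small : r <= delta * (Rabs (g 1%nat) / 2).

(** The majorant estimate: the ball of radius [delta] of the series that are
    absolutely summable at [r] is preserved by [inverse_step], because
    [(r + tail) / Rabs g1 <= delta], where each of [r] and [tail] is at most
    half of [delta * Rabs g1]. *)
Lemma inverse_step_bound (b : nat -> R) :
  b 0%nat = 0 -> ex_series (fun n => Rabs (b n) * r ^ n) ->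
  Series (fun n => Rabs (b n) * r ^ n) <= delta ->
  ex_series (fun n => Rabs (inverse_step b n) * r ^ n) /\
  Series (fun n => Rabs (inverse_step b n) * r ^ n) <= delta.
Proof.
  intros Hb0 Hex Hle. pose proof (Rabs_pos_lt _ g1) as Hg1.
  set (X := fun n => Rabs (b n) * r ^ n).
  assert (HX0 : X 0%nat = 0) by (unfold X; rewrite Hb0, Rabs_R0; ring).
  assert (HX : forall n, Rabs (X n) <= X n).
  { intros n. apply Req_le, Rabs_pos_eq. apply Rmult_le_pos; [apply Rabs_pos|].
    apply pow_le; lra. }
  destruct (comp_coef_series (degree_ge2 g) X X delta HX0 HX Hex Hle tail_ex) as [HQ [HQle _]].
  set (e := fun n => match n with 1%nat => 1 | _ => 0 end * r ^ n).
  assert (He : is_series e r).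
  { replace r with (sum_f_R0 e 1) by (unfold e; simpl; ring).
    apply (is_series_finite e 1). intros [|[|n]] Hn; [lia|lia|]. unfold e; ring. }
  set (Q := comp_coef (fun m => Rabs (degree_ge2 g m)) X) in *.
  assert (Hs : is_series (fun n => / Rabs (g 1%nat) * (e n + Q n))
     (/ Rabs (g 1%nat) * (r + Series Q))).
  { apply is_series_scal_R.
    exact (is_series_plus _ _ _ _ He (Series_correct _ HQ)). }
  assert (Hterm : forall n, 0 <= Rabs (inverse_step b n) * r ^ n
    <= / Rabs (g 1%nat) * (e n + Q n)).
  { intros n. assert (Hrn : 0 <= r ^ n) by (apply pow_le; lra). split.
    - apply Rmult_le_pos; [apply Rabs_pos|exact Hrn].
    - unfold inverse_step, Rdiv. rewrite Rabs_mult, Rabs_inv.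
      rewrite (Rmult_comm (Rabs _)), Rmult_assoc.
      apply Rmult_le_compat_l; [left; apply Rinv_0_lt_compat, Hg1|].
      replace (Q n) with (comp_coef (fun m => Rabs (degree_ge2 g m)) (fun k => Rabs (b k)) n * r ^ n)
        by (symmetry; apply (comp_coef_scale _ (fun k => Rabs (b k)))).
      unfold e. rewrite <- Rmult_plus_distr_r. apply Rmult_le_compat_r; [exact Hrn|].
      eapply Rle_trans; [apply Rabs_triang|]. rewrite Rabs_Ropp. apply Rplus_le_compat.
      + destruct n as [|[|n]]; rewrite ?Rabs_R0, ?Rabs_R1; lra.
      + unfold comp_coef. eapply Rle_trans; [apply Rsum_abs|]. apply sum_Rle. intros m _.
        rewrite Rabs_mult. apply Rmult_le_compat_l; [apply Rabs_pos|].
        apply conv_pow_abs. intros; lra. }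
  split.
  - apply ex_series_le_R with (fun n => / Rabs (g 1%nat) * (e n + Q n)); [|eexists; exact Hs].
    intros n. rewrite Rabs_pos_eq; apply Hterm.
  - eapply Rle_trans; [apply Series_le; [exact Hterm|eexists; exact Hs]|].
    rewrite (is_series_unique _ _ Hs).
    apply Rle_trans with (/ Rabs (g 1%nat) * (delta * Rabs (g 1%nat))).
    + apply Rmult_le_compat_l; [left; apply Rinv_0_lt_compat, Hg1|]. lra.
    + apply Req_le. field. lra.
Qed.

(** A partial sum up to [K] involves only coefficients on which the limit
    agrees with the iterate [K], so the bound for the iterates passes to the
    limit. *)
Lemma inverse_coef_bound :
  ex_series (fun n => Rabs (inverse_coef n) * r ^ n) /\
  Series (fun n => Rabs (inverse_coef n) * r ^ n) <= delta.
Proof.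
  assert (Hpos : forall (b : nat -> R) n, 0 <= Rabs (b n) * r ^ n).
  { intros b n. apply Rmult_le_pos; [apply Rabs_pos|apply pow_le; lra]. }
  assert (HK : forall K, ex_series (fun n => Rabs (inverse_approx K n) * r ^ n) /\
    Series (fun n => Rabs (inverse_approx K n) * r ^ n) <= delta).
  { induction K as [|K [IHex IHle]].
    - apply pos_series_bounded; [apply Hpos|]. intros n.
      rewrite sum_eq_R0; [lra|]. intros k _. simpl. rewrite Rabs_R0. ring.
    - apply inverse_step_bound; auto using inverse_approx_0. }
  apply pos_series_bounded; [apply Hpos|]. intros K. destruct (HK K) as [Hex Hle].
  eapply Rle_trans; [|exact Hle].
  replace (sum_f_R0 (fun n => Rabs (inverse_coef n) * r ^ n) K)
    with (sum_f_R0 (fun n => Rabs (inverse_approx K n) * r ^ n) K).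
  - apply sum_le_series; [apply Hpos|apply Series_correct, Hex].
  - apply sum_eq. intros n Hn. rewrite inverse_approx_coef by exact Hn. reflexivity.
Qed.
End FormalInverse.

(** The formal inverse converges by [inverse_coef_bound], and substituting
    it into [G] gives the series [g 0 + x] by [comp_coef_inverse]. *)
Theorem analytic1_local_inverse G t0 :
  analytic1 G t0 -> Derive G t0 <> 0 ->
  exists Phi, analytic1 Phi 0 /\ Phi 0 = 0 /\
    locally 0 (fun x => G (t0 + Phi x) = G t0 + x).
Proof.
  intros HG HG1. apply analytic1_expansion in HG. destruct HG as [g [d HE]].
  destruct (expansion1_coef _ _ _ _ HE) as [Hg0 Hg1]. destruct HE as [Hd [Hg HGs]].
  rewrite Hg1 in HG1. pose proof (Rabs_pos_lt _ HG1) as Hg1pos.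
  set (c := fun m => Rabs (degree_ge2 g m)).
  assert (Hc0 : forall m, 0 <= c (S m)) by (intros; apply Rabs_pos).
  assert (Hcex : ex_series (fun m => c (S m) * d ^ m)).
  { apply ex_series_ext_R with (fun m => / d * (c (S m) * d ^ S m)).
    { intros m. simpl. field. lra. }
    apply (ex_series_scal (/ d) (fun m => c (S m) * d ^ S m)).
    apply (ex_series_incr_1 (fun m => c m * d ^ m)).
    apply ex_series_le_R with (fun m => Rabs (g m) * d ^ m); [|exact Hg].
    intros m. assert (0 <= d ^ m) by (apply pow_le; lra).
    rewrite Rabs_pos_eq by (apply Rmult_le_pos; [apply Rabs_pos|assumption]).
    apply Rmult_le_compat_r; [assumption|]. unfold c.
    destruct m as [|[|m]]; simpl; rewrite ?Rabs_R0; auto using Rabs_pos; lra. }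
  (* one power of [delta] is split off, so that the tail is small compared to
     [delta] itself *)
  destruct (small_series (fun m => c (S m)) d (Rabs (g 1%nat) / 2) Hc0) as [delta [Hdelta [Hex Hsum]]];
    [apply Rabs_R0|exact Hd|lra|exact Hcex|].
  assert (Hshift : ex_series (fun m => c m * delta ^ m)).
  { apply ex_series_incr_1. apply ex_series_ext_R with (fun m => delta * (c (S m) * delta ^ m)).
    { intros m. simpl. ring. }
    exact (ex_series_scal delta _ Hex). }
  assert (Hsmall : Series (fun m => c m * delta ^ m) <= delta * (Rabs (g 1%nat) / 2)).
  { rewrite Series_incr_1 by exact Hshift.
    replace (c 0%nat * delta ^ 0) with 0 by (unfold c; simpl; rewrite Rabs_R0; ring).
    rewrite (Series_ext _ (fun m => delta * (c (S m) * delta ^ m)))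
      by (intros; simpl; ring).
    rewrite Series_scal_l, Rplus_0_l. apply Rmult_le_compat_l; lra. }
  set (r := delta * (Rabs (g 1%nat) / 2)).
  assert (Hr : 0 < r) by (apply Rmult_lt_0_compat; lra).
  destruct (inverse_coef_bound g HG1 delta r ltac:(lra) Hshift Hsmall Hr (Rle_refl r))
    as [Hbex Hble].
  set (b := inverse_coef g) in *.
  assert (HPhi : forall x, Rabs x <= r -> is_series (fun n => b n * x ^ n) (PSeries b x)).
  { intros x Hx. apply Series_correct. apply ex_series_le_R with (fun n => Rabs (b n) * r ^ n);
      [|exact Hbex].
    intros n. rewrite Rabs_mult, <- RPow_abs. apply Rmult_le_compat_l; [apply Rabs_pos|].
    apply pow_incr. split; [apply Rabs_pos|exact Hx]. }
  exists (PSeries b). split; [|split].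
  - apply analytic1_expansion. exists b, r. repeat split; [exact Hr|exact Hbex|].
    intros x Hx. rewrite Rplus_0_l. apply HPhi, Hx.
  - rewrite PSeries_0. apply inverse_coef_0, HG1.
  - apply locally_R. exists r. split; [exact Hr|]. intros x Hx. rewrite Rminus_0_r in Hx.
    assert (Hterm : forall n, Rabs (b n * x ^ n) <= Rabs (b n) * r ^ n).
    { intros n. rewrite Rabs_mult, <- RPow_abs. apply Rmult_le_compat_l; [apply Rabs_pos|].
      apply pow_incr. split; [apply Rabs_pos|lra]. }
    assert (Hgd : ex_series (fun m => Rabs (g m) * delta ^ m)).
    { apply ex_series_le_R with (fun m => Rabs (g m) * d ^ m); [|exact Hg].
      intros m. rewrite Rabs_mult, Rabs_Rabsolu, (Rabs_pos_eq (delta ^ m)) by (apply pow_le; lra).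
      apply Rmult_le_compat_l; [apply Rabs_pos|]. apply pow_incr; lra. }
    destruct (comp_coef_series g (fun n => b n * x ^ n) (fun n => Rabs (b n) * r ^ n) delta)
      as [_ [_ Hcomp]]; auto.
    { unfold b. rewrite inverse_coef_0 by exact HG1. rewrite Rabs_R0. ring. }
    rewrite (is_series_unique _ _ (HPhi x ltac:(lra))) in Hcomp.
    assert (Hval : is_series (comp_coef g (fun n => b n * x ^ n)) (g 0%nat + x)).
    { set (v := fun n => match n with O => g 0%nat | 1%nat => 1 | _ => 0 end * x ^ n).
      apply is_series_ext_R with v.
      { intros n. unfold v. rewrite comp_coef_scale. unfold b.
        rewrite comp_coef_inverse by exact HG1. reflexivity. }
      replace (g 0%nat + x) with (sum_f_R0 v 1) by (unfold v; simpl; ring).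
      apply (is_series_finite v 1). intros [|[|n]] Hn; [lia|lia|]. unfold v; ring. }
    assert (Hle : Rabs (PSeries b x) <= d).
    { apply Rle_trans with delta; [|lra]. eapply Rle_trans; [|exact Hble].
      eapply Rle_trans; [apply Series_Rabs|].
      - apply ex_series_le_R with (fun n => Rabs (b n) * r ^ n); [|exact Hbex].
        intros n. rewrite Rabs_Rabsolu. apply Hterm.
      - apply Series_le; [|exact Hbex]. intros n. split; [apply Rabs_pos|apply Hterm]. }
    rewrite Hg0, <- (is_series_unique _ _ Hval), (is_series_unique _ _ Hcomp).
    symmetry. apply is_series_unique, HGs, Hle.
Qed.

(** * Differentiability, mixed partial derivatives and a Gronwall lemma *)

(** Beyond the linear terms the expansion is at most [K * d ^ 2], where [d] is
    the distance to the centre in the maximum norm. *)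
Lemma analytic2_differentiable f s t :
  analytic2 f s t -> differentiable_pt_lim f s t (D_s f s t) (D_t f s t).
Proof.
  intros Hf. apply analytic2_expansion in Hf.
  destruct Hf as [N [p [r [Hr [Hp [HN Hs]]]]]].
  assert (HN0 : forall n, 0 <= N n) by (intros n; eapply homogeneous_nonneg, Hp).
  destruct (homogeneous_coef _ _ _ (Hp 0%nat)) as [c0 [Hc0 _]].
  destruct (homogeneous_coef _ _ _ (Hp 1%nat)) as [c1 [Hc1 _]].
  assert (HNtail : ex_series (fun n => N (S (S n)) * r ^ n)).
  { apply ex_series_ext_R with (fun n => / r ^ 2 * (N (S (S n)) * r ^ S (S n))).
    { intros n. simpl. field. lra. }
    apply (ex_series_scal (/ r ^ 2) (fun n => N (S (S n)) * r ^ S (S n))).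
    apply (ex_series_incr_n (fun n => N n * r ^ n) 2). exact HN. }
  set (K := Series (fun n => N (S (S n)) * r ^ n)).
  assert (HK : 0 <= K).
  { apply Rle_trans with (sum_f_R0 (fun n => N (S (S n)) * r ^ n) 0).
    - simpl. rewrite Rmult_1_r. apply HN0.
    - apply sum_le_series; [|apply Series_correct, HNtail].
      intros n. apply Rmult_le_pos; [apply HN0|apply pow_le; lra]. }
  assert (Htaylor : forall h k, Rabs h <= r -> Rabs k <= r ->
    Rabs (f (s + h) (t + k) - c0 0%nat - (c1 1%nat * h + c1 0%nat * k))
      <= K * Rmax (Rabs h) (Rabs k) ^ 2).
  { intros h k Hh Hk. set (d := Rmax (Rabs h) (Rabs k)).
    assert (Hhd : Rabs h <= d) by apply Rmax_l. assert (Hkd : Rabs k <= d) by apply Rmax_r.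
    assert (Hd0 : 0 <= d) by (pose proof (Rabs_pos h); lra).
    assert (Hdr : d <= r) by (apply Rmax_lub; assumption).
    pose proof (Hs h k Hh Hk) as H. pose proof (ex_intro _ _ H) as Hex.
    assert (Heq : f (s + h) (t + k) - c0 0%nat - (c1 1%nat * h + c1 0%nat * k)
      = Series (fun n => p (S (S n)) h k)).
    { rewrite <- (is_series_unique _ _ H).
      rewrite (Series_incr_n (fun n => p n h k) 2) by (lia || exact Hex).
      simpl. rewrite Hc0, Hc1. simpl. ring. }
    rewrite Heq.
    assert (Hterm : forall n, Rabs (p (S (S n)) h k) <= d ^ 2 * (N (S (S n)) * r ^ n)).
    { intros n. eapply Rle_trans; [apply (homogeneous_bound _ _ _ d h k (Hp (S (S n)))); assumption|].
      replace (N (S (S n)) * d ^ S (S n)) with (d ^ 2 * (N (S (S n)) * d ^ n)) by (simpl; ring).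
      apply Rmult_le_compat_l; [apply pow_le, Hd0|].
      apply Rmult_le_compat_l; [apply HN0|]. apply pow_incr; lra. }
    assert (Hex2 : ex_series (fun n => d ^ 2 * (N (S (S n)) * r ^ n)))
      by exact (ex_series_scal (d ^ 2) _ HNtail).
    eapply Rle_trans; [apply Series_Rabs|].
    - apply ex_series_le_R with (fun n => d ^ 2 * (N (S (S n)) * r ^ n)); [|exact Hex2].
      intros n. rewrite Rabs_Rabsolu. apply Hterm.
    - eapply Rle_trans; [apply Series_le; [|exact Hex2]|].
      + intros n. split; [apply Rabs_pos|apply Hterm].
      + rewrite Series_scal_l. fold K. lra. }
  assert (Hdiff : differentiable_pt_lim f s t (c1 1%nat) (c1 0%nat)).
  { intros eps. pose proof (cond_pos eps) as He.
    assert (Hd : 0 < Rmin r (eps / (K + 1))).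
    { apply Rmin_glb_lt; [exact Hr|apply Rdiv_lt_0_compat; lra]. }
    exists (mkposreal _ Hd). simpl. intros u v Hu Hv.
    pose proof (Rmin_l r (eps / (K + 1))). pose proof (Rmin_r r (eps / (K + 1))).
    assert (Hf0 : f s t = c0 0%nat).
    { pose proof (Htaylor 0 0) as H'. rewrite Rabs_R0, !Rplus_0_r, Rmax_left in H' by lra.
      specialize (H' ltac:(lra) ltac:(lra)).
      replace (K * 0 ^ 2) with 0 in H' by ring.
      pose proof (Rabs_pos (f s t - c0 0%nat - (c1 1%nat * 0 + c1 0%nat * 0))).
      assert (H2 : f s t - c0 0%nat - (c1 1%nat * 0 + c1 0%nat * 0) = 0)
        by (apply Rabs_eq_0; lra). lra. }
    pose proof (Htaylor (u - s) (v - t) ltac:(lra) ltac:(lra)) as HT.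
    replace (s + (u - s)) with u in HT by ring. replace (t + (v - t)) with v in HT by ring.
    rewrite Hf0. eapply Rle_trans; [exact HT|].
    set (d := Rmax (Rabs (u - s)) (Rabs (v - t))).
    assert (Hd0 : 0 <= d) by (eapply Rle_trans; [apply Rabs_pos|apply Rmax_l]).
    assert (Hdlt : d <= eps / (K + 1)) by (apply Rmax_lub; lra).
    replace (K * d ^ 2) with (K * d * d) by ring.
    apply Rmult_le_compat_r; [exact Hd0|].
    apply Rle_trans with ((K + 1) * (eps / (K + 1))).
    - apply Rmult_le_compat; lra.
    - apply Req_le. field. lra. }
  destruct (differentiable_pt_lim_unique _ _ _ _ _ Hdiff) as [H1 H2].
  unfold D_s, D_t. rewrite H1, H2. exact Hdiff.
Qed.

Lemma analytic2_is_derive_curve f (x y : R -> R) v dx dy :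
  analytic2 f (x v) (y v) -> is_derive x v dx -> is_derive y v dy ->
  is_derive (fun w => f (x w) (y w)) v (D_s f (x v) (y v) * dx + D_t f (x v) (y v) * dy).
Proof.
  intros Hf Hx Hy. apply is_derive_Reals.
  apply derivable_pt_lim_comp_2d; [|apply is_derive_Reals..]; try assumption.
  apply analytic2_differentiable, Hf.
Qed.

Lemma analytic2_is_derive_s f s t :
  analytic2 f s t -> is_derive (fun x => f x t) s (D_s f s t).
Proof.
  intros Hf. replace (D_s f s t) with (D_s f s t * 1 + D_t f s t * 0) by ring.
  apply (analytic2_is_derive_curve f (fun x => x) (fun _ => t)); [exact Hf| |];
    auto_derive; reflexivity || exact I.
Qed.

Lemma analytic2_is_derive_t f s t :
  analytic2 f s t -> is_derive (fun y => f s y) t (D_t f s t).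
Proof.
  intros Hf. replace (D_t f s t) with (D_s f s t * 0 + D_t f s t * 1) by ring.
  apply (analytic2_is_derive_curve f (fun _ => s) (fun y => y)); [exact Hf| |];
    auto_derive; reflexivity || exact I.
Qed.

(** On half the radius, the Lipschitz constants [n * N n * (r/2) ^ (n-1)] of
    the homogeneous parts are dominated by [2 / r * (N n * r ^ n)], since
    [n <= 2 ^ n]. *)
Lemma analytic2_locally_lipschitz f s t : analytic2 f s t ->
  exists L r, 0 < r /\ forall x y y',
    Rabs (x - s) < r -> Rabs (y - t) < r -> Rabs (y' - t) < r ->
    Rabs (f x y - f x y') <= L * Rabs (y - y').
Proof.
  intros Hf. apply analytic2_expansion in Hf.
  destruct Hf as [N [p [r [Hr [Hp [HN Hs]]]]]].
  assert (HN0 : forall n, 0 <= N n) by (intros n; eapply homogeneous_nonneg, Hp).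
  exists (2 / r * Series (fun n => N n * r ^ n)), (r / 2). split; [lra|].
  intros x y y' Hx Hy Hy'.
  pose proof (Hs (x - s) (y - t) ltac:(lra) ltac:(lra)) as H1.
  pose proof (Hs (x - s) (y' - t) ltac:(lra) ltac:(lra)) as H2.
  replace (s + (x - s)) with x in H1, H2 by ring.
  replace (t + (y - t)) with y in H1 by ring. replace (t + (y' - t)) with y' in H2 by ring.
  pose proof (is_series_minus _ _ _ _ H1 H2) as H3.
  assert (Hgeo : forall n, INR n * (r / 2) ^ (n - 1) <= 2 / r * r ^ n).
  { intros [|n]; [simpl; rewrite Rmult_0_l, Rmult_1_r; apply Rlt_le, Rdiv_lt_0_compat; lra|].
    assert (Hn : INR (S n) <= 2 ^ S n).
    { clear. induction (S n) as [|m IH]; [simpl; lra|]. rewrite S_INR. simpl.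
      assert (1 <= 2 ^ m) by (apply pow_R1_Rle; lra). lra. }
    replace (S n - 1)%nat with n by lia. unfold Rdiv. rewrite Rpow_mult_distr, pow_inv.
    replace (2 * / r * r ^ S n) with (2 ^ S n * (r ^ n * / 2 ^ n)).
    - apply Rmult_le_compat_r; [|exact Hn].
      apply Rmult_le_pos; [apply pow_le; lra|]. left. apply Rinv_0_lt_compat, pow_lt. lra.
    - simpl. field. repeat split; first [lra | apply pow_nonzero; lra]. }
  set (T := fun n => Rabs (y - y') * (2 / r * (N n * r ^ n))).
  assert (HTex : ex_series T).
  { apply (ex_series_scal (Rabs (y - y')) (fun n => 2 / r * (N n * r ^ n))).
    exact (ex_series_scal (2 / r) _ HN). }
  assert (Hterm : forall n, Rabs (p n (x - s) (y - t) - p n (x - s) (y' - t)) <= T n).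
  { intros n. eapply Rle_trans;
      [apply (homogeneous_lipschitz n (N n) (p n) (r / 2)); [apply Hp|lra|lra|lra]|].
    replace (y - t - (y' - t)) with (y - y') by ring.
    unfold T. rewrite (Rmult_comm (Rabs _)).
    apply Rmult_le_compat_r; [apply Rabs_pos|].
    replace (INR n * N n * (r / 2) ^ (n - 1)) with (N n * (INR n * (r / 2) ^ (n - 1))) by ring.
    replace (2 / r * (N n * r ^ n)) with (N n * (2 / r * r ^ n)) by ring.
    apply Rmult_le_compat_l; [apply HN0|apply Hgeo]. }
  replace (f x y - f x y') with (Series (fun n => p n (x - s) (y - t) - p n (x - s) (y' - t)))
    by exact (is_series_unique _ _ H3).
  eapply Rle_trans; [apply Series_Rabs|].
  - apply ex_series_le_R with T; [|exact HTex]. intros n. rewrite Rabs_Rabsolu. apply Hterm.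
  - eapply Rle_trans; [apply Series_le; [|exact HTex]|].
    + intros n. split; [apply Rabs_pos|apply Hterm].
    + unfold T. rewrite !Series_scal_l. lra.
Qed.

Lemma is_derive_lipschitz_bound g x l L :
  is_derive g x l -> locally x (fun y => Rabs (g y - g x) <= L * Rabs (y - x)) ->
  Rabs l <= L.
Proof.
  intros Hd HL. apply is_derive_Reals in Hd. apply Rnot_lt_le. intros Hlt.
  destruct (Hd (Rabs l - L) ltac:(lra)) as [d1 H1].
  apply locally_R in HL. destruct HL as [d2 [Hd2 H2]].
  set (h := Rmin d1 d2 / 2). assert (Hm : 0 < Rmin d1 d2)
    by (apply Rmin_glb_lt; [apply cond_pos|exact Hd2]).
  pose proof (Rmin_l d1 d2) as Hm1. pose proof (Rmin_r d1 d2) as Hm2.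
  assert (Hh : 0 < h) by (unfold h; lra).
  assert (Hah : Rabs h = h) by (apply Rabs_pos_eq; lra).
  specialize (H1 h ltac:(lra) ltac:(rewrite Hah; unfold h; lra)).
  specialize (H2 (x + h)). replace (x + h - x) with h in H2 by ring.
  rewrite Hah in H2. specialize (H2 ltac:(unfold h; lra)).
  assert (H3 : Rabs ((g (x + h) - g x) / h) <= L).
  { unfold Rdiv. rewrite Rabs_mult, Rabs_inv, Hah.
    apply Rmult_le_reg_r with h; [exact Hh|]. rewrite Rmult_assoc, Rinv_l by lra. lra. }
  pose proof (Rabs_triang_inv l ((g (x + h) - g x) / h)) as H4.
  rewrite Rabs_minus_sym in H4. lra.
Qed.

Lemma analytic2_D_t_bounded f s t :
  locally ((s, t) : R * R) (fun z => analytic2 f (fst z) (snd z)) ->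
  exists L r, 0 < r /\ forall x y,
    Rabs (x - s) < r -> Rabs (y - t) < r -> Rabs (D_t f x y) <= L.
Proof.
  intros Hf. destruct (analytic2_locally_lipschitz f s t (locally_singleton _ _ Hf))
    as [L [r1 [Hr1 HL]]].
  apply locally_prod in Hf. destruct Hf as [r2 [Hr2 Hf]].
  exists L, (Rmin r1 r2). split; [apply Rmin_glb_lt; assumption|]. intros x y Hx Hy.
  pose proof (Rmin_l r1 r2). pose proof (Rmin_r r1 r2).
  apply (is_derive_lipschitz_bound (fun y => f x y) y).
  - apply analytic2_is_derive_t. apply (Hf x y); lra.
  - apply locally_R. exists (r1 - Rabs (y - t)). split; [lra|]. intros y' Hy'.
    apply HL; [lra| |lra].
    replace (y' - t) with ((y' - y) + (y - t)) by ring.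
    eapply Rle_lt_trans; [apply Rabs_triang|]. lra.
Qed.

(** By the mean value theorem in the first variable, the second difference is
    [h * (fx c (t + h) - fx c t)]; differentiability of [fx] at [(s, t)]
    replaces both values by their linear parts, and the terms in [c - s]
    cancel. *)
Lemma second_difference f fx s t r lx ly :
  0 < r ->
  (forall x y, Rabs (x - s) < r -> Rabs (y - t) < r ->
    is_derive (fun z => f z y) x (fx x y)) ->
  differentiable_pt_lim fx s t lx ly ->
  forall eps : posreal, exists d, 0 < d /\ forall h, 0 < h < d ->
    Rabs (f (s + h) (t + h) - f (s + h) t - f s (t + h) + f s t - h * h * ly) <= eps * (h * h).
Proof.
  intros Hr Hfx Hdiff eps. pose proof (cond_pos eps) as He.
  assert (He2 : 0 < eps / 2) by lra.
  destruct (Hdiff (mkposreal _ He2)) as [d Hd]. simpl in Hd. pose proof (cond_pos d) as Hd0.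
  exists (Rmin r d). split; [apply Rmin_glb_lt; assumption|].
  intros h [Hh0 Hh]. pose proof (Rmin_l r d) as Hm1. pose proof (Rmin_r r d) as Hm2.
  assert (Hah : Rabs h = h) by (apply Rabs_pos_eq; lra).
  destruct (MVT_cor4 (fun x => f x (t + h) - f x t) (fun x => fx x (t + h) - fx x t) s h)
    with (b := s + h) as [c [Hc Hcs]].
  - intros c Hc. apply @is_derive_minus; apply Hfx; try lra.
    + replace (t + h - t) with h by ring. lra.
    + rewrite Rminus_diag, Rabs_R0. lra.
  - replace (s + h - s) with h by ring. lra.
  - replace (s + h - s) with h in * by ring. rewrite Hah in Hcs.
    pose proof (Hd c (t + h) ltac:(lra)) as H1.
    replace (t + h - t) with h in H1 by ring. specialize (H1 ltac:(lra)).
    pose proof (Hd c t ltac:(lra)) as H2. rewrite Rminus_diag, Rabs_R0 in H2.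
    specialize (H2 ltac:(lra)).
    rewrite Hah, (Rmax_right (Rabs (c - s)) h) in H1 by lra.
    rewrite (Rmax_left (Rabs (c - s)) 0) in H2 by apply Rabs_pos.
    replace (f (s + h) (t + h) - f (s + h) t - f s (t + h) + f s t - h * h * ly)
      with (h * ((fx c (t + h) - fx s t - (lx * (c - s) + ly * h))
        - (fx c t - fx s t - (lx * (c - s) + ly * 0)))) by lra.
    rewrite Rabs_mult, Hah.
    replace (eps * (h * h)) with (h * (eps / 2 * h + eps / 2 * h)) by field.
    apply Rmult_le_compat_l; [lra|].
    eapply Rle_trans; [apply Rabs_triang|]. rewrite Rabs_Ropp.
    apply Rplus_le_compat; [exact H1|]. eapply Rle_trans; [exact H2|].
    apply Rmult_le_compat_l; lra.
Qed.

(** Young's form of the symmetry of second derivatives: the second difference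
    is symmetric in the two variables, and by [second_difference] it is
    [h * h * ly] and [h * h * mx] up to [o(h * h)]. *)
Lemma mixed_partials_eq f fx fy s t r lx ly mx my :
  0 < r ->
  (forall x y, Rabs (x - s) < r -> Rabs (y - t) < r ->
    is_derive (fun z => f z y) x (fx x y) /\ is_derive (fun z => f x z) y (fy x y)) ->
  differentiable_pt_lim fx s t lx ly ->
  differentiable_pt_lim fy s t mx my ->
  ly = mx.
Proof.
  intros Hr Hf Hx Hy.
  assert (Hy' : differentiable_pt_lim (fun y x => fy x y) t s my mx).
  { intros eps. destruct (Hy eps) as [d Hd]. exists d. intros y x H1 H2.
    specialize (Hd x y H2 H1). rewrite Rmax_comm, (Rplus_comm (my * _)). exact Hd. }
  assert (Heps : forall eps : posreal, Rabs (ly - mx) <= 2 * eps).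
  { intros eps. pose proof (cond_pos eps) as He0.
    destruct (second_difference f fx s t r lx ly Hr) with (eps := eps) as [d1 [Hd1 H1]];
      [intros; apply Hf; assumption|exact Hx|].
    destruct (second_difference (fun y x => f x y) (fun y x => fy x y) t s r my mx Hr)
      with (eps := eps) as [d2 [Hd2 H2]];
      [intros; apply Hf; assumption|exact Hy'|].
    set (h := Rmin d1 d2 / 2). assert (Hm : 0 < Rmin d1 d2) by (apply Rmin_glb_lt; assumption).
    pose proof (Rmin_l d1 d2) as Hm1. pose proof (Rmin_r d1 d2) as Hm2.
    assert (Hh : 0 < h) by (unfold h; lra).
    specialize (H1 h ltac:(unfold h; lra)). specialize (H2 h ltac:(unfold h; lra)).
    apply Rmult_le_reg_l with (h * h); [nra|].
    rewrite <- (Rabs_pos_eq (h * h)) at 1 by nra. rewrite <- Rabs_mult.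
    replace (h * h * (ly - mx)) with
      ((f (s + h) (t + h) - f s (t + h) - f (s + h) t + f s t - h * h * mx)
        - (f (s + h) (t + h) - f (s + h) t - f s (t + h) + f s t - h * h * ly)) by ring.
    eapply Rle_trans; [apply Rabs_triang|]. rewrite Rabs_Ropp. lra. }
  apply Rminus_diag_uniq, Rabs_eq_0, Rle_antisym; [|apply Rabs_pos].
  apply Rnot_lt_le. intros Hlt.
  assert (H4 : 0 < Rabs (ly - mx) / 4) by lra.
  specialize (Heps (mkposreal _ H4)). simpl in Heps. lra.
Qed.

(** The function [h^2 exp(- 2 K (x - a))] is nonincreasing and
    [h^2 exp(2 K (x - a))] is nondecreasing; the first settles [a <= b] and
    the second [b < a]. *)
Lemma gronwall_zero (h dh : R -> R) a b K :
  (forall x, Rmin a b <= x <= Rmax a b -> is_derive h x (dh x)) ->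
  (forall x, Rmin a b <= x <= Rmax a b -> Rabs (dh x) <= K * Rabs (h x)) ->
  h a = 0 -> h b = 0.
Proof.
  intros Hd HK Ha.
  assert (HE : forall k, exists c, Rmin a b <= c <= Rmax a b /\
    h b * h b * exp (k * (b - a))
    = (2 * (h c * dh c) + k * (h c * h c)) * exp (k * (c - a)) * (b - a)).
  { intros k. set (E := fun x => h x * h x * exp (k * (x - a))).
    assert (HdE : forall x, Rmin a b <= x <= Rmax a b ->
      is_derive E x ((2 * (h x * dh x) + k * (h x * h x)) * exp (k * (x - a)))).
    { intros x Hx. specialize (Hd x Hx). unfold E. auto_derive.
      - repeat split; eexists; exact Hd.
      - rewrite (is_derive_unique (fun y : R => h y) x (dh x) Hd). unfold Rminus. ring. }
    destruct (MVT_gen E a b (fun x => (2 * (h x * dh x) + k * (h x * h x)) * exp (k * (x - a))))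
      as [c [Hc Heq]].
    - intros x Hx. apply HdE. lra.
    - intros x Hx. apply continuity_pt_filterlim, (@ex_derive_continuous R_AbsRing R_NormedModule).
      eexists. apply HdE, Hx.
    - exists c. split; [exact Hc|]. rewrite <- Heq. unfold E. rewrite Ha. ring. }
  assert (Hhd : forall c, Rmin a b <= c <= Rmax a b ->
    Rabs (h c * dh c) <= K * (h c * h c)).
  { intros c Hc. rewrite Rabs_mult.
    replace (h c * h c) with (Rabs (h c) * Rabs (h c))
      by (rewrite <- Rabs_mult; apply Rabs_pos_eq; nra).
    replace (K * (Rabs (h c) * Rabs (h c))) with (Rabs (h c) * (K * Rabs (h c))) by ring.
    apply Rmult_le_compat_l; [apply Rabs_pos|apply HK, Hc]. }
  assert (Hneg : exists k, h b * h b * exp (k * (b - a)) <= 0).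
  { destruct (Rle_lt_dec a b) as [Hab|Hab].
    - exists (- (2 * K)). destruct (HE (- (2 * K))) as [c [Hc ->]].
      specialize (Hhd c Hc). pose proof (Rle_abs (h c * dh c)).
      pose proof (exp_pos (- (2 * K) * (c - a))).
      set (e := exp (- (2 * K) * (c - a))) in *.
      assert (0 <= e * (b - a)) by nra.
      assert (2 * (h c * dh c) + - (2 * K) * (h c * h c) <= 0) by lra.
      set (q := 2 * (h c * dh c) + - (2 * K) * (h c * h c)) in *. nra.
    - exists (2 * K). destruct (HE (2 * K)) as [c [Hc ->]].
      specialize (Hhd c Hc). pose proof (Rabs_maj2 (h c * dh c)).
      pose proof (exp_pos (2 * K * (c - a))).
      set (e := exp (2 * K * (c - a))) in *.
      assert (0 <= e * (a - b)) by nra.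
      assert (0 <= 2 * (h c * dh c) + 2 * K * (h c * h c)) by lra.
      set (q := 2 * (h c * dh c) + 2 * K * (h c * h c)) in *.
      assert (0 <= q * (e * (a - b))) by (apply Rmult_le_pos; assumption). lra. }
  destruct Hneg as [k Hk]. pose proof (exp_pos (k * (b - a))) as He.
  apply Rsqr_0_uniq. apply Rle_antisym; [|apply Rle_0_sqr].
  apply Rmult_le_reg_r with (exp (k * (b - a))); [exact He|]. unfold Rsqr. lra.
Qed.

(** * The formula solves the system *)

(** [auto_derive] produces [Derive (fun x => A x)] where the other terms have
    [Derive A], and [ring] takes these for different atoms. *)
Ltac eta_contract :=
  repeat match goal with
  | |- context [fun x : R => ?g x] => change (fun x : R => g x) with g
  end.

Lemma open_locally (U : R * R -> Prop) s t :
  open U -> U (s, t) -> locally ((s, t) : R * R) U.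
Proof. intros HU H. exact (HU (s, t) H). Qed.

Lemma locally_section_t (P : R * R -> Prop) s t :
  locally ((s, t) : R * R) P -> locally t (fun y => P (s, y)).
Proof.
  intros H. apply locally_prod in H. destruct H as [r [Hr H]].
  apply locally_R. exists r. split; [exact Hr|]. intros y Hy. apply H; [|exact Hy].
  rewrite Rminus_diag, Rabs_R0. exact Hr.
Qed.

Lemma locally_section_s (P : R * R -> Prop) s t :
  locally ((s, t) : R * R) P -> locally s (fun x => P (x, t)).
Proof.
  intros H. apply locally_prod in H. destruct H as [r [Hr H]].
  apply locally_R. exists r. split; [exact Hr|]. intros x Hx. apply H; [exact Hx|].
  rewrite Rminus_diag, Rabs_R0. exact Hr.
Qed.

Lemma analytic2_phase A u s t :
  analytic2 u s t -> analytic1 A (u s t) ->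
  analytic2 (fun x y => A (u x y) * x + u x y) s t.
Proof.
  intros Hu HA. apply analytic2_plus; [|exact Hu].
  apply analytic2_mult; [apply (analytic2_comp A u); assumption|apply analytic2_fst].
Qed.

Lemma formula_analytic (U : R * R -> Prop) A C F u (s t : R) :
  admissible U A C F u -> U (s, t) -> analytic_at (formula A C F u) s t.
Proof.
  intros Hadm HU. destruct (Hadm s t HU) as [Hu [HA [HC [HF [_ [HF1 HA1]]]]]].
  set (w := fun x y => A (u x y) * x + u x y).
  pose proof (analytic2_phase A u s t Hu HA : analytic2 w s t) as Hw.
  assert (HA2 : analytic2 (fun x y => A (u x y)) s t) by (apply (analytic2_comp A u); assumption).
  assert (HDA : analytic2 (fun x y => Derive A (u x y)) s t)
    by (apply (analytic2_comp (Derive A) u); [apply analytic1_Derive|]; assumption).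
  assert (HDC : analytic2 (fun x y => Derive C (u x y)) s t)
    by (apply (analytic2_comp (Derive C) u); [apply analytic1_Derive|]; assumption).
  assert (HDF : analytic2 (fun x y => Derive F (w x y)) s t)
    by (apply (analytic2_comp (Derive F) w); [apply analytic1_Derive|]; assumption).
  assert (HC2 : analytic2 (fun x y => C (u x y)) s t) by (apply (analytic2_comp C u); assumption).
  assert (Hcos : analytic2 (fun x y => cos (C (u x y))) s t)
    by (apply (analytic2_comp cos (fun x y => C (u x y))); [apply analytic1_cos_sin|exact HC2]).
  assert (Hsin : analytic2 (fun x y => sin (C (u x y))) s t)
    by (apply (analytic2_comp sin (fun x y => C (u x y))); [apply analytic1_cos_sin|exact HC2]).
  assert (Hden : analytic2 (fun x y => Derive A (u x y) * x + 1) s t).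
  { apply analytic2_plus; [|apply analytic2_const].
    apply analytic2_mult; [exact HDA|apply analytic2_fst]. }
  assert (Hk : analytic2 (fun x y => - ((A (u x y)) ^ 2 * Derive C (u x y)
      / (Derive A (u x y) * x + 1))) s t).
  { apply analytic2_opp, analytic2_div; [|exact Hden|exact HA1].
    apply analytic2_mult; [|exact HDC].
    apply analytic2_ext with (fun x y => A (u x y) * A (u x y)); [intros; ring|].
    apply analytic2_mult; exact HA2. }
  assert (Hom : analytic2 (fun x y => A (u x y) * Derive C (u x y)
      / (Derive F (w x y) * (Derive A (u x y) * x + 1))) s t).
  { apply analytic2_div.
    - apply analytic2_mult; assumption.
    - apply analytic2_mult; assumption.
    - apply Rmult_integral_contrapositive; split; assumption. }
  assert (Hv : analytic2 (fun x y => 1 / Derive F (w x y)) s t).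
  { apply analytic2_div; [apply analytic2_const|exact HDF|exact HF1]. }
  repeat split; simpl; apply analytic2_mult; assumption.
Qed.

(** Both derivatives of [F (A(u) s + u) = t] are known: [0] in [s] and [1] in
    [t]. *)
Lemma phase_partials (U : R * R -> Prop) A C F u (s t : R) :
  open U -> admissible U A C F u -> U (s, t) ->
  D_s u s t = - A (u s t) / (Derive A (u s t) * s + 1) /\
  D_t u s t = / (Derive F (A (u s t) * s + u s t) * (Derive A (u s t) * s + 1)).
Proof.
  intros HU Hadm HUst. destruct (Hadm s t HUst) as [Hu [HA [HC [HF [_ [HF1 HA1]]]]]].
  pose proof (open_locally U s t HU HUst) as Hloc.
  pose proof (analytic1_ex_derive _ _ HA) as HA'.
  pose proof (analytic1_ex_derive _ _ HF) as HF'.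
  pose proof (analytic2_is_derive_s _ _ _ Hu) as Hus.
  pose proof (analytic2_is_derive_t _ _ _ Hu) as Hut.
  assert (Hs : is_derive (fun x => F (A (u x t) * x + u x t)) s
    (Derive F (A (u s t) * s + u s t)
      * (D_s u s t * (Derive A (u s t) * s + 1) + A (u s t)))).
  { auto_derive.
    - repeat split; try assumption; eexists; exact Hus.
    - rewrite (is_derive_unique (fun x : R => u x t) s _ Hus). simpl. eta_contract. ring. }
  assert (Ht : is_derive (fun y => F (A (u s y) * s + u s y)) t
    (Derive F (A (u s t) * s + u s t)
      * (D_t u s t * (Derive A (u s t) * s + 1)))).
  { auto_derive.
    - repeat split; try assumption; eexists; exact Hut.
    - rewrite (is_derive_unique (fun y : R => u s y) t _ Hut). simpl. eta_contract. ring. }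
  assert (Hs0 : is_derive (fun x => F (A (u x t) * x + u x t)) s 0).
  { apply is_derive_ext_loc with (fun _ => t); [|apply @is_derive_const].
    generalize (locally_section_s _ _ _ Hloc). apply filter_imp. intros x Hx. apply (Hadm x t Hx). }
  assert (Ht1 : is_derive (fun y => F (A (u s y) * s + u s y)) t 1).
  { apply is_derive_ext_loc with (fun y => y); [|apply @is_derive_id].
    generalize (locally_section_t _ _ _ Hloc). apply filter_imp. intros y Hy. apply (Hadm s y Hy). }
  apply is_derive_unique in Hs. apply is_derive_unique in Ht.
  rewrite (is_derive_unique _ _ _ Hs0) in Hs. rewrite (is_derive_unique _ _ _ Ht1) in Ht.
  set (f1 := Derive F (A (u s t) * s + u s t)) in *.
  set (q := Derive A (u s t) * s + 1) in *. split.
  - apply Rmult_eq_reg_l with q; [|exact HA1].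
    apply Rmult_eq_reg_l with f1; [|exact HF1]. field_simplify; [|exact HA1]. lra.
  - apply Rmult_eq_reg_l with (f1 * q); [|apply Rmult_integral_contrapositive; split; assumption].
    rewrite Rinv_r by (apply Rmult_integral_contrapositive; split; assumption). lra.
Qed.

Lemma formula_system (U : R * R -> Prop) A C F u (s t : R) :
  open U -> admissible U A C F u -> U (s, t) -> system_at (formula A C F u) s t.
Proof.
  intros HU Hadm HUst. destruct (phase_partials U A C F u s t HU Hadm HUst) as [Hs Ht].
  destruct (Hadm s t HUst) as [Hu [HA [HC [HF [_ [HF1 HA1]]]]]].
  pose proof (analytic1_ex_derive _ _ HA) as HA'.
  pose proof (analytic1_ex_derive _ _ HC) as HC'.
  pose proof (analytic1_ex_derive _ _ (analytic1_Derive _ _ HA)) as HA''.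
  pose proof (analytic1_ex_derive _ _ (analytic1_Derive _ _ HC)) as HC''.
  pose proof (analytic1_ex_derive _ _ (analytic1_Derive _ _ HF)) as HF''.
  pose proof (analytic2_is_derive_s _ _ _ Hu) as Hus.
  pose proof (analytic2_is_derive_t _ _ _ Hu) as Hut.
  pose proof (is_derive_unique (fun x => u x t) s _ Hus : Derive (fun x => u x t) s = _) as Eus.
  pose proof (is_derive_unique (fun y => u s y) t _ Hut : Derive (fun y => u s y) t = _) as Eut.
  assert (Exs : ex_derive (fun x => u x t) s) by (eexists; exact Hus).
  assert (Ext : ex_derive (fun y => u s y) t) by (eexists; exact Hut).
  rewrite Hs in Eus. rewrite Ht in Eut.
  unfold system_at, D_s, D_t; simpl.
  assert (Hfq : Derive F (A (u s t) * s + u s t) * (Derive A (u s t) * s + 1) <> 0)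
    by (apply Rmult_integral_contrapositive; split; assumption).
  split; [|split; [|split; [|split; [|split]]]].
  - match goal with |- Derive ?f ?x = Derive ?g ?y =>
      (* the derivatives are computed with [u_s] and [u_t] replaced by the values
         from [phase_partials]; the equation is then a field identity *)
      eassert (H1 : is_derive f x _)
        by (auto_derive; [repeat split; assumption|rewrite Eut; reflexivity]);
      eassert (H2 : is_derive g y _)
        by (auto_derive; [repeat split; assumption|rewrite Eus; reflexivity])
    end.
    rewrite (is_derive_unique _ _ _ H1), (is_derive_unique _ _ _ H2).
    eta_contract. field. split; assumption.
  - match goal with |- Derive ?f ?x = Derive ?g ?y =>
      eassert (H1 : is_derive f x _)
        by (auto_derive; [repeat split; assumption|rewrite Eut; reflexivity]);
      eassert (H2 : is_derive g y _)
        by (auto_derive; [repeat split; assumption|rewrite Eus; reflexivity])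
    end.
    rewrite (is_derive_unique _ _ _ H1), (is_derive_unique _ _ _ H2).
    eta_contract. field. split; assumption.
  - match goal with |- Derive ?f ?x = _ =>
      eassert (H1 : is_derive f x _)
        by (auto_derive; [repeat split; assumption|rewrite Eus; reflexivity])
    end.
    rewrite (is_derive_unique _ _ _ H1).
    eta_contract. field. split; assumption.
  - match goal with |- Derive ?f ?x = _ =>
      eassert (H1 : is_derive f x _)
        by (auto_derive; [repeat split; assumption|rewrite Eus; reflexivity])
    end.
    rewrite (is_derive_unique _ _ _ H1).
    eta_contract. field. split; assumption.
  - field. split; assumption.
  - field. split; assumption.
Qed.

(** * The system in polar coordinates *)

Lemma D_s_mult f g s t : analytic2 f s t -> analytic2 g s t ->
  D_s (fun x y => f x y * g x y) s t = D_s f s t * g s t + f s t * D_s g s t.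
Proof.
  intros Hf Hg. apply (Derive_mult (fun x => f x t) (fun x => g x t));
    eexists; apply analytic2_is_derive_s; assumption.
Qed.

Lemma D_t_mult f g s t : analytic2 f s t -> analytic2 g s t ->
  D_t (fun x y => f x y * g x y) s t = D_t f s t * g s t + f s t * D_t g s t.
Proof.
  intros Hf Hg. apply (Derive_mult (f s) (g s));
    eexists; apply (analytic2_is_derive_t _ s t); assumption.
Qed.

Lemma D_s_comp phi f s t : ex_derive phi (f s t) -> analytic2 f s t ->
  D_s (fun x y => phi (f x y)) s t = Derive phi (f s t) * D_s f s t.
Proof.
  intros Hp Hf. rewrite Rmult_comm. apply (Derive_comp phi (fun x => f x t)); [exact Hp|].
  eexists; apply analytic2_is_derive_s; assumption.
Qed.

Lemma D_t_comp phi f s t : ex_derive phi (f s t) -> analytic2 f s t ->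
  D_t (fun x y => phi (f x y)) s t = Derive phi (f s t) * D_t f s t.
Proof.
  intros Hp Hf. rewrite Rmult_comm. apply (Derive_comp phi (f s)); [exact Hp|].
  eexists; apply (analytic2_is_derive_t _ s t); assumption.
Qed.

Lemma D_s_ext_loc f g s t :
  locally ((s, t) : R * R) (fun z => f (fst z) (snd z) = g (fst z) (snd z)) ->
  D_s f s t = D_s g s t.
Proof. intros H. apply Derive_ext_loc, (locally_section_s _ s t H). Qed.

Lemma D_t_ext_loc f g s t :
  locally ((s, t) : R * R) (fun z => f (fst z) (snd z) = g (fst z) (snd z)) ->
  D_t f s t = D_t g s t.
Proof. intros H. apply Derive_ext_loc, (locally_section_t _ s t H). Qed.

(** The derivative of a vector in a moving orthonormal frame, in components. *)
Lemma polar_D_s m theta f1 f2 s t :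
  analytic2 m s t -> analytic2 theta s t ->
  locally ((s, t) : R * R) (fun z =>
    f1 (fst z) (snd z) = m (fst z) (snd z) * cos (theta (fst z) (snd z)) /\
    f2 (fst z) (snd z) = m (fst z) (snd z) * sin (theta (fst z) (snd z))) ->
  D_s f1 s t = D_s m s t * cos (theta s t) - m s t * D_s theta s t * sin (theta s t) /\
  D_s f2 s t = D_s m s t * sin (theta s t) + m s t * D_s theta s t * cos (theta s t).
Proof.
  intros Hm Hth H. split.
  - rewrite (D_s_ext_loc f1 (fun x y => m x y * cos (theta x y)))
      by (revert H; apply filter_imp; intros z Hz; apply Hz).
    rewrite (D_s_mult m (fun x y => cos (theta x y)));
      [|exact Hm|apply (analytic2_comp cos); [apply analytic1_cos_sin|exact Hth]].
    rewrite (D_s_comp cos) by (exact Hth || apply analytic1_ex_derive, analytic1_cos_sin).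
    rewrite (is_derive_unique cos _ _ (is_derive_cos _)). ring.
  - rewrite (D_s_ext_loc f2 (fun x y => m x y * sin (theta x y)))
      by (revert H; apply filter_imp; intros z Hz; apply Hz).
    rewrite (D_s_mult m (fun x y => sin (theta x y)));
      [|exact Hm|apply (analytic2_comp sin); [apply analytic1_cos_sin|exact Hth]].
    rewrite (D_s_comp sin) by (exact Hth || apply analytic1_ex_derive, analytic1_cos_sin).
    rewrite (is_derive_unique sin _ _ (is_derive_sin _)). ring.
Qed.

Lemma polar_D_t m theta f1 f2 s t :
  analytic2 m s t -> analytic2 theta s t ->
  locally ((s, t) : R * R) (fun z =>
    f1 (fst z) (snd z) = m (fst z) (snd z) * cos (theta (fst z) (snd z)) /\
    f2 (fst z) (snd z) = m (fst z) (snd z) * sin (theta (fst z) (snd z))) ->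
  D_t f1 s t = D_t m s t * cos (theta s t) - m s t * D_t theta s t * sin (theta s t) /\
  D_t f2 s t = D_t m s t * sin (theta s t) + m s t * D_t theta s t * cos (theta s t).
Proof.
  intros Hm Hth H. split.
  - rewrite (D_t_ext_loc f1 (fun x y => m x y * cos (theta x y)))
      by (revert H; apply filter_imp; intros z Hz; apply Hz).
    rewrite (D_t_mult m (fun x y => cos (theta x y)));
      [|exact Hm|apply (analytic2_comp cos); [apply analytic1_cos_sin|exact Hth]].
    rewrite (D_t_comp cos) by (exact Hth || apply analytic1_ex_derive, analytic1_cos_sin).
    rewrite (is_derive_unique cos _ _ (is_derive_cos _)). ring.
  - rewrite (D_t_ext_loc f2 (fun x y => m x y * sin (theta x y)))
      by (revert H; apply filter_imp; intros z Hz; apply Hz).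
    rewrite (D_t_mult m (fun x y => sin (theta x y)));
      [|exact Hm|apply (analytic2_comp sin); [apply analytic1_cos_sin|exact Hth]].
    rewrite (D_t_comp sin) by (exact Hth || apply analytic1_ex_derive, analytic1_cos_sin).
    rewrite (is_derive_unique sin _ _ (is_derive_sin _)). ring.
Qed.

(** Used to compare the components of two vectors in the frame of angle [x]. *)
Lemma rotation_injective p q p' q' x :
  p * cos x - q * sin x = p' * cos x - q' * sin x ->
  p * sin x + q * cos x = p' * sin x + q' * cos x -> p = p' /\ q = q'.
Proof.
  intros H1 H2. pose proof (sin2_cos2 x) as H. unfold Rsqr in H. split.
  - replace p with (p * (sin x * sin x + cos x * cos x)) by (rewrite H; ring).
    replace p' with (p' * (sin x * sin x + cos x * cos x)) by (rewrite H; ring).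
    replace (p * (sin x * sin x + cos x * cos x))
      with (cos x * (p * cos x - q * sin x) + sin x * (p * sin x + q * cos x)) by ring.
    rewrite H1, H2. ring.
  - replace q with (q * (sin x * sin x + cos x * cos x)) by (rewrite H; ring).
    replace q' with (q' * (sin x * sin x + cos x * cos x)) by (rewrite H; ring).
    replace (q * (sin x * sin x + cos x * cos x))
      with (cos x * (p * sin x + q * cos x) - sin x * (p * cos x - q * sin x)) by ring.
    rewrite H1, H2. ring.
Qed.

Definition polar (k w rho theta : R -> R -> R) : fields :=
  Fields
    (fun s t => k s t * cos (theta s t)) (fun s t => k s t * sin (theta s t))
    (fun s t => w s t * cos (theta s t)) (fun s t => w s t * sin (theta s t))
    (fun s t => rho s t * cos (theta s t)) (fun s t => rho s t * sin (theta s t)).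

Definition polar_regular (U : R * R -> Prop) (k w rho theta : R -> R -> R) : Prop :=
  forall s t, U (s, t) ->
    analytic2 k s t /\ analytic2 w s t /\ analytic2 rho s t /\ analytic2 theta s t /\
    k s t <> 0 /\ w s t <> 0 /\ rho s t <> 0.

(** The angle is [atan (upsilon2 / upsilon1)], whose cosine never vanishes;
    dividing the first components by this cosine gives (signed) lengths, which
    the algebraic equations make consistent with the second components. *)
Lemma polar_form U X : analytic_solution U X -> nonvanishing U X ->
  exists k w rho theta, polar_regular U k w rho theta /\ agree_on U X (polar k w rho theta).
Proof.
  intros HX Hnv.
  set (theta := fun s t => atan (upsilon2 X s t / upsilon1 X s t)).
  exists (fun s t => kappa1 X s t / cos (theta s t)),
    (fun s t => omega1 X s t / cos (theta s t)),
    (fun s t => upsilon1 X s t / cos (theta s t)), theta.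
  assert (Hcos : forall s t, cos (theta s t) <> 0).
  { intros s t. pose proof (atan_bound (upsilon2 X s t / upsilon1 X s t)).
    apply Rgt_not_eq, cos_gt_0; unfold theta; lra. }
  assert (Hnz : forall s t, U (s, t) -> kappa1 X s t <> 0 /\ omega1 X s t <> 0 /\
    upsilon1 X s t <> 0).
  { intros s t HU. specialize (Hnv s t HU).
    repeat split; intros H; apply Hnv; rewrite H; ring. }
  split.
  - intros s t HU. destruct (HX s t HU) as [[Hk1 [_ [Hw1 [_ [Hu1 Hu2]]]]] _].
    destruct (Hnz s t HU) as [Hk0 [Hw0 Hu0]].
    assert (Hth : analytic2 theta s t).
    { apply (analytic2_comp atan (fun x y => upsilon2 X x y / upsilon1 X x y));
        [apply analytic1_atan|apply analytic2_div; assumption]. }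
    assert (Hc : analytic2 (fun x y => cos (theta x y)) s t)
      by (apply (analytic2_comp cos); [apply analytic1_cos_sin|exact Hth]).
    repeat split; try (apply analytic2_div; auto); try exact Hth;
      apply Rmult_integral_contrapositive; split; try assumption;
      apply Rinv_neq_0_compat, Hcos.
  - intros s t HU. destruct (HX s t HU) as [_ [_ [_ [_ [_ [H1 H2]]]]]].
    destruct (Hnz s t HU) as [Hk0 [Hw0 Hu0]].
    assert (Htan : sin (theta s t) / cos (theta s t) = upsilon2 X s t / upsilon1 X s t)
      by (apply tan_atan).
    specialize (Hcos s t). simpl.
    assert (Hm : forall m, m / cos (theta s t) * sin (theta s t)
      = m * (upsilon2 X s t / upsilon1 X s t)).
    { intros m. rewrite <- Htan. field. exact Hcos. }
    rewrite !Hm.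
    assert (Hk2 : kappa2 X s t = kappa1 X s t * (upsilon2 X s t / upsilon1 X s t)).
    { apply Rmult_eq_reg_l with (upsilon1 X s t); [|exact Hu0]. field_simplify; [lra|exact Hu0]. }
    repeat split; try (field; assumption).
    + exact Hk2.
    + apply Rmult_eq_reg_r with (kappa1 X s t); [|exact Hk0].
      replace (omega1 X s t * (upsilon2 X s t / upsilon1 X s t) * kappa1 X s t)
        with (omega1 X s t * (kappa1 X s t * (upsilon2 X s t / upsilon1 X s t))) by ring.
      rewrite <- Hk2. lra.
Qed.

Definition polar_system_at (k w rho theta : R -> R -> R) (s t : R) : Prop :=
  D_s rho s t = 0 /\ rho s t * D_s theta s t = - w s t /\
  D_t k s t = D_s w s t /\ k s t * D_t theta s t = w s t * D_s theta s t.

Lemma polar_system U X k w rho theta :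
  open U -> analytic_solution U X -> polar_regular U k w rho theta ->
  agree_on U X (polar k w rho theta) ->
  forall s t, U (s, t) -> polar_system_at k w rho theta s t.
Proof.
  intros HU HX Hreg Hag s t Hst.
  destruct (Hreg s t Hst) as [Hk [Hw [Hrho [Hth _]]]].
  destruct (HX s t Hst) as [_ [E1 [E2 [E3 [E4 _]]]]].
  pose proof (open_locally U s t HU Hst) as Hloc.
  destruct (polar_D_t k theta (kappa1 X) (kappa2 X) s t Hk Hth) as [K1 K2].
  { revert Hloc. apply filter_imp. intros [x y] H. destruct (Hag x y H) as [H1 [H2 _]]. auto. }
  destruct (polar_D_s w theta (omega1 X) (omega2 X) s t Hw Hth) as [W1 W2].
  { revert Hloc. apply filter_imp. intros [x y] H.
    destruct (Hag x y H) as [_ [_ [H1 [H2 _]]]]. auto. }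
  destruct (polar_D_s rho theta (upsilon1 X) (upsilon2 X) s t Hrho Hth) as [V1 V2].
  { revert Hloc. apply filter_imp. intros [x y] H.
    destruct (Hag x y H) as [_ [_ [_ [_ H1]]]]. exact H1. }
  destruct (Hag s t Hst) as [_ [_ [O1 [O2 _]]]]. simpl in O1, O2.
  rewrite K1, W1 in E1. rewrite K2, W2 in E2. rewrite V1, O2 in E3. rewrite V2, O1 in E4.
  destruct (rotation_injective _ _ _ _ _ E1 E2) as [R1 R2].
  destruct (rotation_injective (D_s rho s t) (rho s t * D_s theta s t) 0 (- w s t) (theta s t))
    as [R3 R4]; [lra|lra|].
  repeat split; assumption.
Qed.

(** The speed [a] of the transport equations below; it equals [A(u)]. *)
Definition wave_speed (k w rho : R -> R -> R) (s t : R) : R := - (rho s t * k s t / w s t).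

Lemma wave_speed_analytic U k w rho theta s t :
  polar_regular U k w rho theta -> U (s, t) -> analytic2 (wave_speed k w rho) s t.
Proof.
  intros Hreg Hst. destruct (Hreg s t Hst) as [Hk [Hw [Hrho [_ [_ [Hw0 _]]]]]].
  apply analytic2_opp, analytic2_div; [apply analytic2_mult|..]; assumption.
Qed.

Lemma angle_transport U k w rho theta s t :
  polar_regular U k w rho theta -> U (s, t) -> polar_system_at k w rho theta s t ->
  rho s t * D_s theta s t + wave_speed k w rho s t * D_t theta s t = 0 /\
  wave_speed k w rho s t * D_t theta s t = w s t.
Proof.
  intros Hreg Hst [_ [H1 [_ H2]]].
  destruct (Hreg s t Hst) as [_ [_ [_ [_ [Hk0 [Hw0 Hr0]]]]]].
  assert (H : wave_speed k w rho s t * D_t theta s t = w s t).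
  { unfold wave_speed.
    replace (- (rho s t * k s t / w s t) * D_t theta s t)
      with (- (rho s t / w s t) * (k s t * D_t theta s t)) by (field; exact Hw0).
    rewrite H2.
    replace (- (rho s t / w s t) * (w s t * D_s theta s t))
      with (- (rho s t * D_s theta s t)) by (field; exact Hw0).
    rewrite H1. ring. }
  split; [rewrite H, H1; ring|exact H].
Qed.

(** Burgers' equation for the speed. The angle satisfies
    [theta_s = - w / rho] and [theta_t = w / a], and the equality of its mixed
    derivatives, combined with [k_t = w_s] and [k = - a w / rho], is the
    claimed relation multiplied by [w / a]. *)
Lemma speed_transport U k w rho theta s t :
  open U -> polar_regular U k w rho theta -> U (s, t) ->
  (forall x y, U (x, y) -> polar_system_at k w rho theta x y) ->
  rho s t * D_s (wave_speed k w rho) s t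
    + wave_speed k w rho s t * D_t (wave_speed k w rho) s t = 0.
Proof.
  intros HU Hreg Hst Hsys. set (a := wave_speed k w rho).
  pose proof (open_locally U s t HU Hst) as Hloc.
  assert (Ha0 : forall x y, U (x, y) -> a x y <> 0).
  { intros x y H. destruct (Hreg x y H) as [_ [_ [_ [_ [Hk0 [Hw0 Hr0]]]]]].
    unfold a, wave_speed. apply Ropp_neq_0_compat.
    apply Rmult_integral_contrapositive; split; [|apply Rinv_neq_0_compat, Hw0].
    apply Rmult_integral_contrapositive; split; assumption. }
  pose proof (wave_speed_analytic U k w rho theta s t Hreg Hst : analytic2 a s t) as Ha.
  destruct (Hreg s t Hst) as [Hk [Hw [Hrho [Hth [Hk0 [Hw0 Hr0]]]]]].
  set (fx := fun x y => - (w x y / rho x y)). set (fy := fun x y => w x y / a x y).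
  assert (Hfx : analytic2 fx s t) by (apply analytic2_opp, analytic2_div; assumption).
  assert (Hfy : analytic2 fy s t) by (apply analytic2_div; auto).
  (* [fx] and [fy] are the partial derivatives of [theta] *)
  assert (Hmix : D_t fx s t = D_s fy s t).
  { apply locally_prod in Hloc. destruct Hloc as [r [Hr Hbox]].
    apply (mixed_partials_eq theta fx fy s t r _ _ _ _ Hr) with
      (3 := analytic2_differentiable fy s t Hfy) (2 := analytic2_differentiable fx s t Hfx).
    intros x y Hx Hy. specialize (Hbox x y Hx Hy).
    destruct (Hreg x y Hbox) as [_ [_ [_ [Hth' [_ [_ Hr0']]]]]].
    destruct (Hsys x y Hbox) as [_ [H1 _]].
    destruct (angle_transport U k w rho theta x y Hreg Hbox (Hsys x y Hbox)) as [_ H2].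
    split.
    - replace (fx x y) with (D_s theta x y); [apply analytic2_is_derive_s, Hth'|].
      unfold fx. apply Rmult_eq_reg_l with (rho x y); [|exact Hr0']. rewrite H1. field. exact Hr0'.
    - replace (fy x y) with (D_t theta x y); [apply (analytic2_is_derive_t theta), Hth'|].
      unfold fy. apply Rmult_eq_reg_l with (a x y); [|apply Ha0, Hbox].
      unfold a at 1. rewrite H2. field. apply Ha0, Hbox. }
  (* the equations fx rho = - w, fy a = w and k rho = - a w, differentiated
     as products *)
  assert (P1 : D_t fx s t * rho s t + fx s t * D_t rho s t = - D_t w s t).
  { rewrite <- D_t_mult by assumption.
    replace (- D_t w s t) with (D_t (fun x y => - w x y) s t) by apply Derive_opp.
    apply D_t_ext_loc. revert Hloc. apply filter_imp. intros [x y] H.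
    unfold fx; simpl. field. apply (Hreg x y H). }
  assert (P2 : D_s fy s t * a s t + fy s t * D_s a s t = D_s w s t).
  { rewrite <- D_s_mult by assumption.
    apply D_s_ext_loc. revert Hloc. apply filter_imp. intros [x y] H.
    unfold fy; simpl. field. apply Ha0, H. }
  assert (P3 : D_t k s t * rho s t + k s t * D_t rho s t
    = - (D_t a s t * w s t + a s t * D_t w s t)).
  { rewrite <- !D_t_mult by assumption.
    replace (- D_t (fun x y => a x y * w x y) s t)
      with (D_t (fun x y => - (a x y * w x y)) s t) by apply Derive_opp.
    apply D_t_ext_loc. revert Hloc. apply filter_imp. intros [x y] H.
    unfold a, wave_speed; simpl. field. apply (Hreg x y H). }
  destruct (Hsys s t Hst) as [_ [_ [H4 _]]]. rewrite H4 in P3. rewrite Hmix in P1.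
  assert (Hk' : k s t = - (a s t * w s t) / rho s t).
  { unfold a, wave_speed. field. split; assumption. }
  rewrite Hk' in P3. specialize (Ha0 s t Hst).
  set (m := D_s fy s t) in *. unfold fx in P1. unfold fy in P2.
  assert (Ewt : D_t w s t = - (m * rho s t - w s t / rho s t * D_t rho s t)) by lra.
  rewrite <- P2, Ewt in P3.
  apply Rmult_eq_reg_l with (w s t / a s t).
  - rewrite Rmult_0_r.
    transitivity ((m * a s t + w s t / a s t * D_s a s t) * rho s t
      + - (a s t * w s t) / rho s t * D_t rho s t
      + (D_t a s t * w s t + a s t * - (m * rho s t - w s t / rho s t * D_t rho s t))).
    + field. split; assumption.
    + rewrite P3. ring.
  - apply Rmult_integral_contrapositive; split; [exact Hw0|apply Rinv_neq_0_compat, Ha0].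
Qed.

(** * Every solution is given by the formula *)

Lemma analytic2_locally_close f s t eps : analytic2 f s t -> 0 < eps ->
  locally ((s, t) : R * R) (fun z => Rabs (f (fst z) (snd z) - f s t) < eps).
Proof.
  intros Hf He.
  assert (Hc : continuity_2d_pt f s t).
  { apply differentiable_continuity_pt. eexists; eexists.
    apply analytic2_differentiable, Hf. }
  apply (proj1 (locally_2d_locally (fun x y => Rabs (f x y - f s t) < eps) s t)).
  exact (Hc (mkposreal eps He)).
Qed.

Lemma analytic2_locally_lt f s t c : analytic2 f s t -> Rabs (f s t) < c ->
  locally ((s, t) : R * R) (fun z => Rabs (f (fst z) (snd z)) < c).
Proof.
  intros Hf Hc.
  generalize (analytic2_locally_close f s t (c - Rabs (f s t)) Hf ltac:(lra)).
  apply filter_imp. intros z Hz.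
  pose proof (Rabs_triang_inv (f (fst z) (snd z)) (f s t)). lra.
Qed.

Lemma open_square e : open (fun z : R * R => Rabs (fst z) < e /\ Rabs (snd z) < e).
Proof.
  intros [s t] [Hs Ht]. apply filter_and.
  - apply (analytic2_locally_lt (fun x _ => x)); [apply analytic2_fst|exact Hs].
  - apply (analytic2_locally_lt (fun _ y => y)); [apply analytic2_snd|exact Ht].
Qed.

Lemma analytic1_continuous f x : analytic1 f x -> continuous f x.
Proof.
  intros Hf. apply (@ex_derive_continuous R_AbsRing R_NormedModule), analytic1_ex_derive, Hf.
Qed.

Lemma analytic1_locally_close f x eps : analytic1 f x -> 0 < eps ->
  locally x (fun y => Rabs (f y - f x) < eps).
Proof.
  intros Hf He. apply (analytic1_continuous f x Hf (fun y => Rabs (y - f x) < eps)).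
  apply locally_R. exists eps. auto.
Qed.

Lemma left_inverse_on (P : R -> Prop) (G : R -> R) :
  (forall t t', P t -> P t' -> G t = G t' -> t = t') ->
  exists F, forall t, P t -> F (G t) = t.
Proof.
  intros Hinj.
  destruct (functional_choice (fun x t => forall t', P t' -> G t' = x -> t = t')) as [F HF].
  - intros x. destruct (classic (exists t', P t' /\ G t' = x)) as [[t [Ht Hx]]|Hn].
    + exists t. intros t' Ht' Hx'. apply Hinj; congruence.
    + exists 0. intros t' Ht' Hx'. exfalso; eauto.
  - exists F. intros t Ht. apply HF; [exact Ht|reflexivity].
Qed.

(** Near [G t] the left inverse [F] coincides with the analytic local inverse
    of [G], because the values of the latter stay in the interval where
    [F (G t') = t']. *)
Lemma analytic1_left_inverse F G e t :
  (forall t', Rabs t' < e -> F (G t') = t') -> Rabs t < e ->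
  analytic1 G t -> Derive G t <> 0 ->
  analytic1 F (G t) /\ Derive F (G t) = / Derive G t /\
  locally (G t) (fun x => exists t', Rabs t' < e /\ G t' = x).
Proof.
  intros HF Ht HG HG1.
  destruct (analytic1_local_inverse G t HG HG1) as [Phi [HPhi [HPhi0 Hinv]]].
  assert (Hloc : locally 0 (fun x => Rabs (t + Phi x) < e /\ G (t + Phi x) = G t + x)).
  { apply filter_and; [|exact Hinv].
    generalize (analytic1_locally_close Phi 0 (e - Rabs t) HPhi ltac:(lra)).
    apply filter_imp. intros x Hx. rewrite HPhi0, Rminus_0_r in Hx.
    pose proof (Rabs_triang t (Phi x)). lra. }
  assert (Hloc' : locally (G t) (fun x => Rabs (t + Phi (x - G t)) < e /\
    G (t + Phi (x - G t)) = x)).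
  { apply locally_R in Hloc. destruct Hloc as [r [Hr Hloc]]. apply locally_R.
    exists r. split; [exact Hr|]. intros x Hx. destruct (Hloc (x - G t)) as [H1 H2].
    - rewrite Rminus_0_r. exact Hx.
    - split; [exact H1|]. rewrite H2. ring. }
  assert (HFan : analytic1 F (G t)).
  { apply analytic1_ext_loc with (fun x => t + Phi (x - G t)).
    - revert Hloc'. apply filter_imp. intros x [H1 H2].
      rewrite <- (HF _ H1) at 1. rewrite H2. reflexivity.
    - apply analytic1_plus; [apply analytic1_const|].
      apply analytic1_translate. rewrite Rminus_diag. exact HPhi. }
  split; [exact HFan|]. split.
  - apply Rmult_eq_reg_r with (Derive G t); [|exact HG1]. rewrite Rinv_l by exact HG1.
    rewrite Rmult_comm, <- (Derive_comp F G t); [|apply analytic1_ex_derive..]; try assumption.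
    rewrite <- (Derive_id t). apply Derive_ext_loc. apply locally_R.
    exists (e - Rabs t). split; [lra|]. intros y Hy. change (F (G y) = y). apply HF.
    replace y with (t + (y - t)) by ring. pose proof (Rabs_triang t (y - t)). lra.
  - revert Hloc'. apply filter_imp. intros x Hx. exists (t + Phi (x - G t)). exact Hx.
Qed.

Lemma between_zero_abs s x e : Rmin s 0 <= x <= Rmax s 0 -> Rabs s < e -> Rabs x < e.
Proof.
  intros Hx Hs. apply Rabs_def2 in Hs. apply Rabs_def1;
    unfold Rmin, Rmax in Hx; destruct (Rle_dec s 0); lra.
Qed.

(** The primitive [G] of [rho] is injective near [0] by the mean value
    theorem, and its left inverse [F] is analytic on the image. The bound [M]
    and the interval of radius [eta] inside the image make the estimates along
    characteristics uniform. *)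
Lemma time_change (rho : R -> R) e0 : 0 < e0 ->
  (forall t, Rabs t < e0 -> analytic1 rho t /\ rho t <> 0) ->
  exists (G F : R -> R) e eta M, 0 < e <= e0 /\ 0 < eta /\ G 0 = 0 /\
    (forall t, Rabs t < e -> is_derive G t (rho t) /\ analytic1 G t /\
       F (G t) = t /\ analytic1 F (G t) /\ Derive F (G t) = / rho t /\ Rabs (/ rho t) <= M) /\
    (forall x, Rabs x < eta -> exists t, Rabs t < e /\ G t = x).
Proof.
  intros He0 H. destruct (H 0) as [Hr0 Hn0]; [rewrite Rabs_R0; exact He0|].
  destruct (analytic1_has_primitive rho 0 Hr0) as [G [d [Hd [HG0 [_ HG]]]]].
  assert (Hinv : analytic1 (fun t => / rho t) 0)
    by (apply (analytic1_comp Rinv rho); [apply analytic1_inv|]; assumption).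
  pose proof (analytic1_locally_close _ _ 1 Hinv Rlt_0_1) as Hc.
  apply locally_R in Hc. destruct Hc as [r [Hr Hc]].
  set (e := Rmin e0 (Rmin d r)).
  assert (He : 0 < e) by (repeat apply Rmin_glb_lt; assumption).
  assert (Hee : e <= e0) by apply Rmin_l.
  assert (Hedr : e <= Rmin d r) by apply Rmin_r.
  pose proof (Rmin_l d r) as Hm1. pose proof (Rmin_r d r) as Hm2.
  assert (Hrho : forall t, Rabs t < e -> analytic1 rho t /\ rho t <> 0 /\
     Rabs (/ rho t) <= Rabs (/ rho 0) + 1).
  { intros t Ht. destruct (H t) as [H1 H2]; [lra|].
    assert (H3 := Hc t ltac:(rewrite Rminus_0_r; lra)). simpl in H3.
    split; [exact H1|split; [exact H2|]].
    pose proof (Rabs_triang_inv (/ rho t) (/ rho 0)). lra. }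
  assert (HGd : forall t, Rabs t < e -> is_derive G t (rho t)).
  { intros t Ht. apply HG. rewrite Rminus_0_r. lra. }
  assert (HGan : forall t, Rabs t < e -> analytic1 G t).
  { intros t Ht. apply analytic1_primitive with rho; [|apply Hrho, Ht].
    apply locally_R. exists (e - Rabs t). split; [lra|]. intros y Hy. apply HGd.
    replace y with (t + (y - t)) by ring. pose proof (Rabs_triang t (y - t)). lra. }
  destruct (left_inverse_on (fun t => Rabs t < e) G) as [F HF].
  { intros t t' Ht Ht' Heq. apply Rabs_def2 in Ht. apply Rabs_def2 in Ht'.
    assert (Hin : forall x, Rmin t t' <= x <= Rmax t t' -> Rabs x < e).
    { intros x Hx. apply Rabs_def1; unfold Rmin, Rmax in Hx; destruct (Rle_dec t t'); lra. }
    destruct (MVT_gen G t t' rho) as [c [Hc' Hmvt]].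
    - intros x Hx. apply HGd, Hin. lra.
    - intros x Hx. apply continuity_pt_filterlim, analytic1_continuous, HGan, Hin, Hx.
    - destruct (Hrho c (Hin c Hc')) as [_ [Hnz _]].
      assert (Hz : rho c * (t' - t) = 0) by lra.
      apply Rmult_integral in Hz. destruct Hz as [Hz|Hz]; [contradiction|lra]. }
  assert (HFG : forall t, Rabs t < e -> analytic1 F (G t) /\ Derive F (G t) = / rho t /\
    locally (G t) (fun x => exists t', Rabs t' < e /\ G t' = x)).
  { intros t Ht. rewrite <- (is_derive_unique G t _ (HGd t Ht)).
    apply (analytic1_left_inverse F G e t HF Ht); [apply HGan, Ht|].
    rewrite (is_derive_unique G t _ (HGd t Ht)). apply Hrho, Ht. }
  assert (H0e : Rabs 0 < e) by (rewrite Rabs_R0; exact He).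
  destruct (HFG 0 H0e) as [_ [_ Himg]]. rewrite HG0 in Himg. apply locally_R in Himg.
  destruct Himg as [eta [Heta Himg]].
  exists G, F, e, eta, (Rabs (/ rho 0) + 1).
  split; [split; assumption|split; [exact Heta|split; [exact HG0|split]]].
  - intros t Ht. destruct (HFG t Ht) as [H1 [H2 _]]. destruct (Hrho t Ht) as [_ [_ H3]].
    auto 10.
  - intros x Hx. apply Himg. rewrite Rminus_0_r. exact Hx.
Qed.


Lemma constant_along_s (rho : R -> R -> R) e s t :
  (forall x, Rabs x < e -> analytic2 rho x t /\ D_s rho x t = 0) ->
  Rabs s < e -> rho s t = rho 0 t.
Proof.
  intros H Hs. symmetry.
  assert (Hz : (fun x => rho x t - rho s t) 0 = 0); [|simpl in Hz; lra].
  apply (gronwall_zero (fun x => rho x t - rho s t) (fun _ => 0) s 0 0).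
  - intros x Hx. destruct (H x (between_zero_abs _ _ _ Hx Hs)) as [Ha Hd].
    replace 0 with (minus (D_s rho x t) 0) by (rewrite Hd; apply (minus_eq_zero 0)).
    apply @is_derive_minus; [apply analytic2_is_derive_s, Ha|apply @is_derive_const].
  - intros. rewrite Rabs_R0. lra.
  - apply Rminus_diag.
Qed.

Section Characteristics.
Variables (a theta : R -> R -> R) (rho G F : R -> R) (e eta L M : R).
Hypothesis transport : forall s t, Rabs s < e -> Rabs t < e ->
  analytic2 a s t /\ analytic2 theta s t /\ rho t <> 0 /\
  rho t * D_s a s t + a s t * D_t a s t = 0 /\
  rho t * D_s theta s t + a s t * D_t theta s t = 0 /\
  Rabs (D_t a s t) <= L.
Hypothesis clock_inverse : forall t, Rabs t < e ->
  F (G t) = t /\ analytic1 F (G t) /\ Derive F (G t) = / rho t /\ Rabs (/ rho t) <= M.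
Hypothesis clock_range : forall x, Rabs x < eta -> exists t, Rabs t < e /\ G t = x.

(** In the time [G], the characteristic through [(s, t)] is the straight line
    of slope [a1 = a s t]. Taking this line as given, the deviation of [a]
    from [a1] along it solves a homogeneous linear equation and vanishes at
    [(s, t)], hence everywhere on the line. *)
Lemma constant_along_characteristic s t :
  Rabs s < e -> Rabs t < e -> Rabs (G t) < eta / 2 -> Rabs (a s t * s) < eta / 2 ->
  a 0 (F (G t - a s t * s)) = a s t /\ theta 0 (F (G t - a s t * s)) = theta s t.
Proof.
  intros Hs Ht HGt Has. set (a1 := a s t) in *.
  set (y := fun x => F (G t - a1 * (s - x))).
  assert (Hy : forall x, Rmin s 0 <= x <= Rmax s 0 ->
    Rabs x < e /\ Rabs (y x) < e /\ is_derive y x (/ rho (y x) * a1) /\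
    Rabs (/ rho (y x)) <= M).
  { intros x Hx. split; [exact (between_zero_abs _ _ _ Hx Hs)|].
    destruct (clock_range (G t - a1 * (s - x))) as [tau [Htau HG]].
    { assert (Hle : Rabs (s - x) <= Rabs s).
      { unfold Rmin, Rmax in Hx. destruct (Rle_dec s 0).
        - rewrite !Rabs_left1; lra.
        - rewrite !Rabs_pos_eq; lra. }
      pose proof (Rabs_triang (G t) (- (a1 * (s - x)))) as Htri.
      rewrite Rabs_Ropp, Rabs_mult in Htri. rewrite Rabs_mult in Has.
      assert (Rabs a1 * Rabs (s - x) <= Rabs a1 * Rabs s)
        by (apply Rmult_le_compat_l; [apply Rabs_pos|exact Hle]).
      unfold Rminus at 1. lra. }
    destruct (clock_inverse tau Htau) as [HF [HFan [HF1 HM]]].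
    assert (Hyx : y x = tau) by (unfold y; rewrite <- HG; exact HF).
    rewrite Hyx. split; [exact Htau|split; [|exact HM]].
    rewrite <- HF1, HG in *.
    replace (Derive F (G t - a1 * (s - x)) * a1)
      with (scal a1 (Derive F (G t - a1 * (s - x))))
      by (unfold scal; simpl; unfold mult; simpl; ring).
    apply (is_derive_comp F (fun x => G t - a1 * (s - x))).
    - apply Derive_correct, analytic1_ex_derive. exact HFan.
    - auto_derive; [exact I|ring]. }
  assert (Hys : y s = t).
  { unfold y. rewrite Rminus_diag, Rmult_0_r, Rminus_0_r. apply clock_inverse, Ht. }
  assert (Ha : forall x, Rmin s 0 <= x <= Rmax s 0 -> a x (y x) = a1).
  { intros x Hx.
    assert (Hz : (fun x => a x (y x) - a1) x = 0); [|simpl in Hz; lra].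
    apply (gronwall_zero (fun x => a x (y x) - a1)
      (* by the transport equation this derivative is
         [- (D_t a / rho) * (a - a1)], and [L * M] bounds the factor *)
      (fun x => D_s a x (y x) * 1 + D_t a x (y x) * (/ rho (y x) * a1) - 0) s x (L * M)).
    - intros x' Hx'.
      destruct (Hy x') as [Hx'e [Hye [Hyd _]]].
      { unfold Rmin, Rmax in *. destruct (Rle_dec s 0), (Rle_dec s x); lra. }
      apply @is_derive_minus; [|apply @is_derive_const].
      apply (analytic2_is_derive_curve a (fun x => x) y);
        [apply transport; assumption|apply @is_derive_id|exact Hyd].
    - intros x' Hx'.
      destruct (Hy x') as [Hx'e [Hye [_ HM]]].
      { unfold Rmin, Rmax in *. destruct (Rle_dec s 0), (Rle_dec s x); lra. }
      destruct (transport x' (y x') Hx'e Hye) as [_ [_ [Hr0 [Htr [_ HL]]]]].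
      replace (D_s a x' (y x') * 1 + D_t a x' (y x') * (/ rho (y x') * a1) - 0)
        with (- (D_t a x' (y x') * / rho (y x') * (a x' (y x') - a1))).
      + rewrite Rabs_Ropp, !Rabs_mult. apply Rmult_le_compat_r; [apply Rabs_pos|].
        apply Rmult_le_compat; auto using Rabs_pos.
      + apply Rmult_eq_reg_l with (rho (y x')); [|exact Hr0].
        replace (rho (y x') * - (D_t a x' (y x') * / rho (y x') * (a x' (y x') - a1)))
          with (- (a x' (y x') * D_t a x' (y x')) + D_t a x' (y x') * a1) by (field; exact Hr0).
        replace (- (a x' (y x') * D_t a x' (y x'))) with (rho (y x') * D_s a x' (y x')) by lra.
        field. exact Hr0.
    - rewrite Hys. apply Rminus_diag. }
  assert (H0 : Rmin s 0 <= 0 <= Rmax s 0).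
  { split; [apply Rmin_r|apply Rmax_r]. }
  assert (Hy0 : y 0 = F (G t - a1 * s)) by (unfold y; rewrite Rminus_0_r; reflexivity).
  rewrite <- Hy0. split; [apply Ha, H0|].
  assert (Hz : (fun x => theta x (y x) - theta s t) 0 = 0); [|simpl in Hz; lra].
  apply (gronwall_zero (fun x => theta x (y x) - theta s t)
    (fun x => D_s theta x (y x) * 1 + D_t theta x (y x) * (/ rho (y x) * a1) - 0) s 0 0).
  - intros x Hx. destruct (Hy x Hx) as [Hxe [Hye [Hyd _]]].
    apply @is_derive_minus; [|apply @is_derive_const].
    apply (analytic2_is_derive_curve theta (fun x => x) y);
      [apply transport; assumption|apply @is_derive_id|exact Hyd].
  - intros x Hx. destruct (Hy x Hx) as [Hxe [Hye _]].
    destruct (transport x (y x) Hxe Hye) as [_ [_ [Hr0 [_ [Htr _]]]]].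
    rewrite (Ha x Hx) in Htr.
    replace (D_s theta x (y x) * 1 + D_t theta x (y x) * (/ rho (y x) * a1) - 0) with 0.
    + rewrite Rabs_R0. lra.
    + apply Rmult_eq_reg_l with (rho (y x)); [|exact Hr0]. rewrite Rmult_0_r.
      etransitivity; [symmetry; exact Htr|]. field. exact Hr0.
  - rewrite Hys. apply Rminus_diag.
Qed.
End Characteristics.

(** The functions [A], [C] are the values of the speed and the angle on the
    line [s = 0], as functions of the time [G]; the neighbourhood [V] is chosen
    so small that the characteristics starting in it reach [s = 0] inside the
    square. *)
Lemma polar_general_solution k w rho theta e0 : 0 < e0 ->
  let B := fun z : R * R => Rabs (fst z) < e0 /\ Rabs (snd z) < e0 in
  polar_regular B k w rho theta ->
  (forall s t, B (s, t) -> polar_system_at k w rho theta s t) ->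
  exists (A C F : R -> R) (u : R -> R -> R) (V : R * R -> Prop),
    analytic1 A 0 /\ analytic1 C 0 /\ analytic1 F 0 /\
    F 0 = 0 /\ Derive F 0 <> 0 /\ u 0 0 = 0 /\
    open V /\ V (0, 0) /\ (forall z, V z -> B z) /\
    admissible V A C F u /\ agree_on V (polar k w rho theta) (formula A C F u).
Proof.
  intros He0 B Hreg Hsys. set (a := wave_speed k w rho).
  assert (HBopen : open B) by apply open_square.
  assert (HB0 : B (0, 0)) by (split; simpl; rewrite Rabs_R0; exact He0).
  assert (Ha : forall s t, B (s, t) -> analytic2 a s t)
    by (intros s t; apply (wave_speed_analytic B k w rho theta s t Hreg)).
  destruct (analytic2_D_t_bounded a 0 0) as [L [r [Hr HL]]].
  { generalize (open_locally B 0 0 HBopen HB0). apply filter_imp. intros [s t]. apply Ha. }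
  set (e1 := Rmin e0 r). assert (He1 : 0 < e1) by (apply Rmin_glb_lt; assumption).
  assert (He10 : e1 <= e0) by apply Rmin_l. assert (He1r : e1 <= r) by apply Rmin_r.
  destruct (time_change (rho 0) e1 He1) as [G [F [e [eta [M [[He Hee1] [Heta [HG0 [HG Hrange]]]]]]]]].
  { intros t Ht. destruct (Hreg 0 t) as [_ [_ [H1 [_ [_ [_ H2]]]]]].
    - split; simpl; [rewrite Rabs_R0|]; lra.
    - split; [apply analytic2_restrict, H1|exact H2]. }
  assert (HinB : forall s t, Rabs s < e -> Rabs t < e -> B (s, t)) by (split; simpl; lra).
  assert (Hrho : forall s t, Rabs s < e -> Rabs t < e -> rho s t = rho 0 t).
  { intros s t Hs Ht. apply (constant_along_s rho e); [|exact Hs]. intros x Hx.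
    split; [apply Hreg|apply (Hsys x t)]; auto. }
  set (u := fun s t => G t - a s t * s).
  set (V := fun z : R * R => (Rabs (fst z) < e /\ Rabs (snd z) < e) /\
    Rabs (G (snd z)) < eta / 2 /\ Rabs (a (fst z) (snd z) * fst z) < eta / 2).
  assert (Hmain : forall s t, V (s, t) -> a 0 (F (u s t)) = a s t /\
     theta 0 (F (u s t)) = theta s t).
  { intros s t [[Hs Ht] [HGt Has]]. simpl in *.
    apply (constant_along_characteristic a theta (rho 0) G F e eta L M); try assumption.
    - intros x y Hx Hy. pose proof (HinB x y Hx Hy) as HBxy. rewrite <- (Hrho x y Hx Hy).
      destruct (Hreg x y HBxy) as [_ [_ [_ [Hth [_ [_ Hr0]]]]]].
      destruct (angle_transport B k w rho theta x y Hreg HBxy (Hsys x y HBxy)) as [Htr _].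
      pose proof (speed_transport B k w rho theta x y HBopen Hreg HBxy Hsys) as Hsp.
      repeat split; auto. apply HL; rewrite Rminus_0_r; lra.
    - intros x Hx. destruct (HG x Hx) as [_ [_ H]]. exact H. }
  assert (Hu : forall s t, V (s, t) -> analytic2 u s t).
  { intros s t [[Hs Ht] _]. apply analytic2_minus.
    - apply analytic2_of_snd, HG, Ht.
    - apply analytic2_mult; [apply Ha, HinB; assumption|apply analytic2_fst]. }
  assert (Hrange_u : forall s t, V (s, t) -> exists tau, Rabs tau < e /\ G tau = u s t).
  { intros s t [_ [HGt Has]]. apply Hrange. simpl in HGt, Has.
    pose proof (Rabs_triang (G t) (- (a s t * s))) as H. rewrite Rabs_Ropp in H.
    unfold u, Rminus. lra. }
  assert (HVopen : open V).
  { intros [s t] [[Hs Ht] [HGt Has]]. cbn [fst snd] in *.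
    apply filter_and; apply filter_and.
    - apply (analytic2_locally_lt (fun x _ => x)); [apply analytic2_fst|exact Hs].
    - apply (analytic2_locally_lt (fun _ y => y)); [apply analytic2_snd|exact Ht].
    - apply (analytic2_locally_lt (fun _ y => G y)); [|exact HGt].
      apply analytic2_of_snd, HG, Ht.
    - apply (analytic2_locally_lt (fun x y => a x y * x)); [|exact Has].
      apply analytic2_mult; [apply Ha, HinB; assumption|apply analytic2_fst]. }
  assert (H0e : Rabs 0 < e) by (rewrite Rabs_R0; exact He).
  assert (HV0 : V (0, 0)).
  { repeat split; simpl; try exact H0e; rewrite ?HG0, ?Rmult_0_r, Rabs_R0; lra. }
  set (A := fun x => a 0 (F x)). set (C := fun x => theta 0 (F x)).
  assert (HAC : forall tau, Rabs tau < e -> analytic1 A (G tau) /\ analytic1 C (G tau)).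
  { intros tau Htau. destruct (HG tau Htau) as [_ [_ [HF [HFan _]]]].
    split; apply (analytic1_comp _ F); try exact HFan; rewrite HF; apply analytic2_restrict.
    - apply Ha, HinB; assumption.
    - apply (Hreg 0 tau), HinB; assumption. }
  assert (Hphase : forall s t, V (s, t) -> A (u s t) * s + u s t = G t).
  { intros s t HV. unfold A. rewrite (proj1 (Hmain s t HV)). unfold u. ring. }
  (* differentiating a = A(u) and theta = C(u) with respect to t *)
  assert (Hchain : forall s t, V (s, t) ->
    analytic1 A (u s t) /\ analytic1 C (u s t) /\
    D_t u s t * (Derive A (u s t) * s + 1) = rho s t /\
    Derive C (u s t) * D_t u s t = D_t theta s t).
  { intros s t HV. destruct (Hrange_u s t HV) as [tau [Htau Hut]].
    destruct (HAC tau Htau) as [HA HC]. rewrite Hut in HA, HC.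
    split; [exact HA|split; [exact HC|]].
    pose proof (open_locally V s t HVopen HV) as Hloc.
    assert (HDa : Derive A (u s t) * D_t u s t = D_t a s t).
    { rewrite <- (D_t_comp A u) by (apply analytic1_ex_derive, HA || apply Hu, HV).
      apply D_t_ext_loc. revert Hloc. apply filter_imp. intros [x y] H. apply Hmain, H. }
    assert (HDth : Derive C (u s t) * D_t u s t = D_t theta s t).
    { rewrite <- (D_t_comp C u) by (apply analytic1_ex_derive, HC || apply Hu, HV).
      apply D_t_ext_loc. revert Hloc. apply filter_imp. intros [x y] H. apply Hmain, H. }
    split; [|exact HDth].
    destruct HV as [[Hs Ht] _]. simpl in Hs, Ht.
    assert (HDu : D_t u s t = rho 0 t - D_t a s t * s).
    { apply is_derive_unique.
      apply @is_derive_minus; [apply HG, Ht|].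
      replace (D_t a s t * s) with (scal s (D_t a s t))
        by (unfold scal; simpl; unfold mult; simpl; ring).
      apply is_derive_ext with (fun y => scal s (a s y));
        [intros y; unfold scal; simpl; unfold mult; simpl; ring|].
      apply @is_derive_scal. apply (analytic2_is_derive_t a), Ha, HinB; assumption. }
    rewrite (Hrho s t Hs Ht). rewrite <- HDa in HDu. lra. }
  (* [u_t (A' s + 1) = rho] excludes the zeros of both factors at once *)
  assert (Hnz : forall s t, V (s, t) -> D_t u s t <> 0 /\ Derive A (u s t) * s + 1 <> 0).
  { intros s t HV. destruct (Hchain s t HV) as [_ [_ [H _]]].
    destruct HV as [[Hs Ht] _]. destruct (Hreg s t (HinB s t Hs Ht)) as [_ [_ [_ [_ [_ [_ Hr0]]]]]].
    split; intros Hz; apply Hr0; rewrite <- H, Hz; ring. }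
  destruct (HG 0 H0e) as [_ [_ [HF0 [HFan0 [HF10 _]]]]]. rewrite HG0 in HF0, HFan0, HF10.
  destruct (HAC 0 H0e) as [HA0 HC0]. rewrite HG0 in HA0, HC0.
  exists A, C, F, u, V.
  split; [exact HA0|split; [exact HC0|split; [exact HFan0|split; [exact HF0|]]]].
  split; [rewrite HF10; apply Rinv_neq_0_compat, (Hreg 0 0 HB0)|].
  split; [unfold u; rewrite HG0; ring|].
  split; [exact HVopen|split; [exact HV0|]].
  split; [intros [s t] [[Hs Ht] _]; apply HinB; assumption|]. split.
  - intros s t HV. rewrite (Hphase s t HV).
    destruct (Hchain s t HV) as [HA [HC _]].
    assert (Ht : Rabs t < e) by apply HV.
    destruct (HG t Ht) as [_ [_ [HF [HFan [HF1 _]]]]].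
    split; [apply Hu, HV|split; [exact HA|split; [exact HC|split; [exact HFan|]]]].
    split; [symmetry; exact HF|split; [|apply Hnz, HV]].
    rewrite HF1. apply Rinv_neq_0_compat, (Hreg 0 t), HinB; assumption.
  - intros s t HV. destruct (Hchain s t HV) as [_ [_ [HAs HC]]].
    destruct (Hnz s t HV) as [Hu0 HA1]. destruct (Hmain s t HV) as [Hma Hmth].
    assert (Hs : Rabs s < e) by apply HV. assert (Ht : Rabs t < e) by apply HV.
    destruct (Hreg s t (HinB s t Hs Ht)) as [_ [_ [_ [_ [Hk0 [Hw0 Hr0]]]]]].
    destruct (angle_transport B k w rho theta s t Hreg (HinB s t Hs Ht)
      (Hsys s t (HinB s t Hs Ht))) as [_ Hw].
    destruct (HG t Ht) as [_ [_ [_ [_ [HF1 _]]]]]. rewrite <- (Hrho s t Hs Ht) in HF1.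
    assert (Ev : 1 / Derive F (A (u s t) * s + u s t) = rho s t).
    { rewrite (Hphase s t HV), HF1. field. exact Hr0. }
    assert (EC : Derive C (u s t) / (Derive A (u s t) * s + 1) = D_t theta s t / rho s t).
    { rewrite <- HC, <- HAs. field. split; assumption. }
    assert (Ew : A (u s t) * Derive C (u s t) /
       (Derive F (A (u s t) * s + u s t) * (Derive A (u s t) * s + 1)) = w s t).
    { transitivity (A (u s t) * (Derive C (u s t) / (Derive A (u s t) * s + 1))
        * (1 / Derive F (A (u s t) * s + u s t))).
      - field. split; [|exact HA1]. rewrite (Hphase s t HV), HF1.
        apply Rinv_neq_0_compat, Hr0.
      - rewrite Ev, EC. unfold A. rewrite Hma. fold a in Hw. rewrite <- Hw.
        field. exact Hr0. }
    assert (Ek : - ((A (u s t)) ^ 2 * Derive C (u s t) / (Derive A (u s t) * s + 1)) = k s t).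
    { transitivity (- (A (u s t) * (A (u s t)
        * (Derive C (u s t) / (Derive A (u s t) * s + 1))))); [field; exact HA1|].
      rewrite EC. unfold A. rewrite Hma.
      replace (a s t * (D_t theta s t / rho s t)) with (w s t / rho s t)
        by (fold a in Hw; rewrite <- Hw; field; exact Hr0).
      unfold a, wave_speed. field. split; assumption. }
    unfold polar, formula. cbn [kappa1 kappa2 omega1 omega2 upsilon1 upsilon2].
    rewrite Ek, Ew, Ev. unfold C. rewrite Hmth. repeat split; reflexivity.
Qed.

Lemma analytic_solution_translate (U : R * R -> Prop) s0 t0 X :
  analytic_solution U X ->
  analytic_solution (fun z => U (fst z + s0, snd z + t0)) (translate s0 t0 X).
Proof.
  intros H s t HU. simpl in HU. destruct (H _ _ HU) as [[H1 [H2 [H3 [H4 [H5 H6]]]]] Hsys].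
  split.
  - repeat split; simpl; apply analytic2_translate; assumption.
  - assert (Hs : forall f, analytic2 f (s + s0) (t + t0) ->
      D_s (fun x y => f (x + s0) (y + t0)) s t = D_s f (s + s0) (t + t0)).
    { intros f Hf. apply is_derive_unique.
      replace (D_s f (s + s0) (t + t0)) with (scal 1 (D_s f (s + s0) (t + t0)))
        by (unfold scal; simpl; unfold mult; simpl; ring).
      apply (is_derive_comp (fun x => f x (t + t0)) (fun x => x + s0));
        [apply analytic2_is_derive_s, Hf|auto_derive; [exact I|ring]]. }
    assert (Ht : forall f, analytic2 f (s + s0) (t + t0) ->
      D_t (fun x y => f (x + s0) (y + t0)) s t = D_t f (s + s0) (t + t0)).
    { intros f Hf. apply is_derive_unique.
      replace (D_t f (s + s0) (t + t0)) with (scal 1 (D_t f (s + s0) (t + t0)))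
        by (unfold scal; simpl; unfold mult; simpl; ring).
      apply (is_derive_comp (f (s + s0)) (fun y => y + t0));
        [apply (analytic2_is_derive_t f), Hf|auto_derive; [exact I|ring]]. }
    unfold system_at, translate. cbn [kappa1 kappa2 omega1 omega2 upsilon1 upsilon2].
    rewrite !Hs, !Ht by assumption. exact Hsys.
Qed.

Theorem theorem1 :
  (forall (U : R * R -> Prop) (A C F : R -> R) (u : R -> R -> R),
     open U ->
     admissible U A C F u ->
     analytic_solution U (formula A C F u))
  /\
  (forall (s0 t0 : R) (U : R * R -> Prop) (X : fields),
     open U -> U (s0, t0) ->
     analytic_solution U X ->
     nonvanishing U X ->
     exists (A C F : R -> R) (u : R -> R -> R) (V : R * R -> Prop),
       analytic1 A 0 /\ analytic1 C 0 /\ analytic1 F 0 /\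
       F 0 = 0 /\ Derive F 0 <> 0 /\
       u 0 0 = 0 /\
       open V /\ V (0, 0) /\
       (forall s t : R, V (s, t) -> U (s + s0, t + t0)) /\
       admissible V A C F u /\
       agree_on V (translate s0 t0 X) (formula A C F u)).
Proof.
  split.
  - intros U A C F u HU Hadm s t Hst. split.
    + apply formula_analytic with U; assumption.
    + apply formula_system with U; assumption.
  - intros s0 t0 U X HU H0 HX Hnv.
    pose proof (open_locally U s0 t0 HU H0) as Hloc. apply locally_prod in Hloc.
    destruct Hloc as [e0 [He0 Hbox]].
    set (B := fun z : R * R => Rabs (fst z) < e0 /\ Rabs (snd z) < e0).
    assert (HBU : forall s t, B (s, t) -> U (s + s0, t + t0)).
    { intros s t [Hs Ht]. apply Hbox; [replace (s + s0 - s0) with s by ring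
        |replace (t + t0 - t0) with t by ring]; assumption. }
    set (Y := translate s0 t0 X).
    assert (HY : analytic_solution B Y).
    { intros s t HB. apply (analytic_solution_translate U s0 t0 X HX), (HBU s t HB). }
    assert (HYnv : nonvanishing B Y).
    { intros s t HB. apply (Hnv (s + s0) (t + t0)), HBU, HB. }
    destruct (polar_form B Y HY HYnv) as [k [w [rho [theta [Hreg Hag]]]]].
    assert (HBopen : open B) by apply open_square.
    destruct (polar_general_solution k w rho theta e0 He0 Hreg
      (polar_system B Y k w rho theta HBopen HY Hreg Hag))
      as [A [C [F [u [V [H1 [H2 [H3 [H4 [H5 [H6 [H7 [H8 [HVB [H9 H10]]]]]]]]]]]]]]].
    exists A, C, F, u, V.
    split; [exact H1|split; [exact H2|split; [exact H3|split; [exact H4|]]]].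
    split; [exact H5|split; [exact H6|split; [exact H7|split; [exact H8|]]]].
    split; [intros s t HV; apply HBU, HVB, HV|split; [exact H9|]].
    intros s t HV. fold Y. destruct (Hag s t (HVB _ HV)) as [-> [-> [-> [-> [-> ->]]]]].
    apply H10, HV.
Qed.
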